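(* Let $\mu$ be a positive measure on $\mathbb{R}^n$ absolutely continuous with respect to Lebesgue measure, let $Q_0$ be a cube with $0<\mu(Q_0)<\infty$, let $0<\varepsilon<2$, and let $f\in GR_\mu(\varepsilon)$ on $Q_0$. Then for every $\lambda$ with $\varepsilon<\lambda<2$, every $\rho$ with $0<\rho<1-\lambda/2$, and every $0<t\le\rho\mu(Q_0)$, $$f_\mu^{**}(t)\le\Big(B(n)\frac{\lambda/\rho+1}{\lambda-\varepsilon}\,\varepsilon+1\Big)f_\mu^*(t).$$
   Context: For a cube $Q$ with $0<\mu(Q)<\infty$ and $f$ $\mu$-integrable on $Q$, define $f_{Q,\mu}=\frac{1}{\mu(Q)}\int_Q f\,d\mu$ and $\Omega_\mu(f;Q)=\frac{1}{\mu(Q)}\int_Q |f(x)-f_{Q,\mu}|\,d\mu(x)$. A nonnegative function $f$, $\mu$-integrable on $Q_0$, belongs to $GR_\mu(\varepsilon)$ (on $Q_0$) if $\Omega_\mu(f;Q)\le\varepsilon f_{Q,\mu}$ for every cube $Q\subset Q_0$ (for which the averages are defined). The non-increasing rearrangement of $f$ on $Q_0$ with respect to $\mu$ is $f_\mu^*(t)=\sup_{E\subset Q_0,\ \mu(E)=t}\inf_{x\in E}|f(x)|$ for $0<t<\mu(Q_0)$, and $f_\mu^{**}(t)=t^{-1}\int_0^t f_\mu^*(\tau)\,d\tau$. $B(n)$ is the dimensional constant of the following covering lemma (Mateu–Mattila–Nicolau–Orobitg), valid for every such $\mu$: if $E\subset Q_0$ and $\mu(E)\le\rho\mu(Q_0)$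 with $0<\rho<1$, then there is a sequence of cubes $Q_i\subset Q_0$ with $\mu(Q_i\cap E)=\rho\mu(Q_i)$ for each $i$, such that every point of $Q_0$ belongs to at most $B(n)$ of the cubes $Q_i$, and the set of $\mu$-density points of $E$ is contained in $\bigcup_i Q_i$. *)

(* Defs.v *)
From HB Require Import structures.
From mathcomp Require Import all_boot all_order all_algebra.
From mathcomp Require Import all_classical all_reals all_analysis.
Set Implicit Arguments. Unset Strict Implicit. Unset Printing Implicit Defensive.
Import Order.TTheory GRing.Theory Num.Theory.
Import numFieldNormedType.Exports.
Local Open Scope classical_set_scope.
Local Open Scope ring_scope.

Definition ccube (R : realType) (n : nat) (c : 'I_n -> R) (r : R)
  : set ('I_n -> R) :=
  [set x | forall i : 'I_n, `|x i - c i| <= r].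

Definition is_cube (R : realType) (n : nat) : set (set ('I_n -> R)) :=
  [set Q | exists c r, 0 < r /\ Q = ccube c r].

(* R^n equipped with its Borel sigma-algebra (generated by cubes). *)
Notation Rn R n := (g_sigma_algebraType (@is_cube R n)).

Definition lebesgue_null (R : realType) (n : nat) (A : set ('I_n -> R)) :=
  forall delta : R, 0 < delta ->
    exists (I : set nat) (c : nat -> ('I_n -> R)) (r : nat -> R),
      (forall k, I k -> 0 < r k) /\
      A `<=` \bigcup_(k in I) ccube (c k) (r k) /\
      (\esum_(k in I) (((2 * r k) ^+ n)%:E) < delta%:E)%E.

Definition abs_cont_lebesgue (R : realType) (n : nat)
  (mu : {measure set (Rn R n) -> \bar R}) :=
  forall A : set (Rn R n), measurable A -> lebesgue_null A -> mu A = 0%E.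

Section Averages.
Context (d : measure_display) (T : measurableType d) (R : realType).
Variable (mu : {measure set T -> \bar R}).

Definition avg (f : T -> R) (Q : set T) : R :=
  fine (\int[mu]_(x in Q) (f x)%:E) / fine (mu Q).

Definition osc (f : T -> R) (Q : set T) : R :=
  fine (\int[mu]_(x in Q) (`|f x - avg f Q|)%:E) / fine (mu Q).

Definition fstar (f : T -> R) (Q0 : set T) (t : R) : \bar R :=
  ereal_sup [set ereal_inf [set (`|f x|)%:E | x in E] |
             E in [set E | measurable E /\ E `<=` Q0 /\ mu E = t%:E]].

Definition fstarstar (f : T -> R) (Q0 : set T) (t : R) : \bar R :=
  ((t^-1)%:E * \int[@lebesgue_measure R]_(tau in `]0%R, t]%classic) fstar f Q0 tau)%E.
End Averages.

Definition GR (R : realType) (n : nat) (mu : {measure set (Rn R n) -> \bar R})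
  (eps : R) (Q0 : set (Rn R n)) (f : Rn R n -> R) :=
  (forall x, Q0 x -> 0 <= f x) /\
  mu.-integrable Q0 (EFin \o f) /\
  forall Q : set (Rn R n), is_cube Q -> Q `<=` Q0 ->
    (0 < mu Q)%E -> (mu Q < +oo)%E ->
    osc mu f Q <= eps * avg mu f Q.

Definition density_point (R : realType) (n : nat)
  (mu : {measure set (Rn R n) -> \bar R}) (E : set (Rn R n)) (x : Rn R n) :=
  forall eta : R, 0 < eta -> exists r0 : R, 0 < r0 /\
    forall r : R, 0 < r -> r < r0 ->
      (0 < mu (ccube x r))%E /\ (mu (ccube x r) < +oo)%E /\
      `|fine (mu (E `&` ccube x r)) / fine (mu (ccube x r)) - 1| < eta.

(* The covering lemma of Mateu-Mattila-Nicolau-Orobitg holds in R^n with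
   overlap constant B (for every mu absolutely continuous w.r.t. Lebesgue). *)
Definition covering_property (R : realType) (n : nat) (B : nat) :=
  forall (mu : {measure set (Rn R n) -> \bar R}) (Q0 E : set (Rn R n)) (rho : R),
    abs_cont_lebesgue mu ->
    is_cube Q0 -> (0 < mu Q0)%E -> (mu Q0 < +oo)%E ->
    measurable E -> E `<=` Q0 -> 0 < rho -> rho < 1 ->
    (mu E <= rho%:E * mu Q0)%E ->
    exists (I : set nat) (Q : nat -> set (Rn R n)),
      (forall i, I i -> [/\ is_cube (Q i), Q i `<=` Q0 &
                           mu (Q i `&` E) = (rho%:E * mu (Q i))%E]) /\
      (forall x, Q0 x -> forall s : seq nat, uniq s ->
          (forall i, i \in s -> I i /\ Q i x) -> (size s <= B)%N) /\
      (density_point mu E `<=` \bigcup_(i in I) Q i).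

(* Main.v *)
Require Import Defs.
From HB Require Import structures.
From mathcomp Require Import all_boot all_order all_algebra.
From mathcomp Require Import finmap.
From mathcomp Require Import all_classical all_reals all_analysis.
From mathcomp Require Import measurable_realfun.
From mathcomp Require Import ring lra.
Import Order.TTheory GRing.Theory Num.Theory.
Import numFieldNormedType.Exports.
Local Open Scope classical_set_scope.
Local Open Scope ring_scope.

Set Implicit Arguments.
Unset Strict Implicit.
Unset Printing Implicit Defensive.

(* Let [a] be the value of the rearrangement at [t] and E = {f > a}, so that
   mu E <= t.  On a cube Q with mu (Q `&` E) = rho mu Q, the function is at most
   [a] on the proportion 1 - rho > lambda / 2 of Q, so the oscillation of f on Q
   is at least 2 (1 - rho) (f_Q - a), and the condition GR gives
   f_Q <= lambda a / (lambda - eps).  As the oscillation is also twice the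
   integral of f - f_Q over Q `&` E up to the factor mu Q, this bounds the
   integral of f - a over Q `&` E by a multiple of a mu (Q `&` E), and summing
   over the cubes of the covering costs the factor B.  Finally, t f**(t) is at
   most a t plus the integral of f - a over E.
   The covering only reaches the density points of E.  That almost every point
   of E is one follows from the Vitali covering theorem for Lebesgue null sets:
   covering the points of low density by disjoint cubes inside an open set of
   almost minimal measure would decrease their outer measure. *)

(** * Disjoint cubes in a bounded region *)

(** An interval of length [2 * r] contains at least [p] points of a lattice of step [h], where [p]
    is the integer part of [2 * r / h]. As this quotient is at least 2, [p] is at least half of it,
    that is [r / h]. *)
Lemma card_lattice_interval (R : realType) (a h c r : R) (M : nat) :
  0 < h -> h <= r -> a <= c - r -> c + r <= a + h * M%:R ->
  r <= h * #|[pred k : 'I_M.+1 | `|a + h * (k : nat)%:R - c| <= r]|%:R.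
Proof.
move=> h0 hr ac caM; set P := [pred k | _].
(* The index [k0] is the first one whose lattice point lies strictly beyond [c - r]. That point is
   at most [c - r + h], so the indices [k0 + j] with [j < p] stay in the interval. *)
pose k0 := (Num.truncn ((c - r - a) / h)).+1.
pose p := Num.truncn (2 * r / h).
have r0 : 0 < r by exact: lt_le_trans hr.
have k0l : c - r <= a + h * k0%:R.
  have := truncnS_gt ((c - r - a) / h).
  rewrite ltr_pdivrMr// -/k0 => /ltW; lra.
have k0u : a + h * k0%:R <= c - r + h.
  have : (Num.truncn ((c - r - a) / h))%:R <= (c - r - a) / h.
    by rewrite truncn_le// divr_ge0 ?(ltW h0)//; lra.
  by rewrite ler_pdivlMr// /k0 -natr1; lra.
have pl : p%:R * h <= 2 * r.
  by rewrite -ler_pdivlMr// truncn_le// divr_ge0 ?(ltW h0)//; lra.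
have pu : 2 * r < (p%:R + 1) * h.
  by rewrite -ltr_pdivrMr// natr1 truncnS_gt.
have jM (j : 'I_p) : (k0 + j < M.+1)%N.
  rewrite ltnS -(ler_nat R) -(ler_pM2l h0) natrD.
  have : ((j : nat)%:R : R) <= p%:R - 1.
    by rewrite lerBrDr natr1 ler_nat.
  nra.
pose g (j : 'I_p) : 'I_M.+1 := Ordinal (jM j).
have ginj : injective g by move=> i j [] /addnI /val_inj.
have : (p <= #|P|)%N.
  rewrite -[X in (X <= _)%N]card_ord -(card_codom ginj).
  apply: subset_leq_card; apply/fintype.subsetP => _ /codomP[j ->].
  rewrite inE /P /= natrD ler_norml.
  have : ((j : nat)%:R : R) <= p%:R - 1.
    by rewrite lerBrDr natr1 ler_nat.
  have : (0 : R) <= (j : nat)%:R by [].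
  by move=> ? ?; apply/andP; split; nra.
rewrite -(ler_nat R) -(ler_pM2l h0); apply: le_trans.
by nra.
Qed.

Lemma count_le1 (T : eqType) (p : pred T) (s : seq T) : uniq s ->
  (forall x y, x \in s -> y \in s -> p x -> p y -> x = y) ->
  (count p s <= 1)%N.
Proof.
move=> us px; rewrite -size_filter.
case E : (seq.filter p s) => [|x l]//.
have xl : x \in seq.filter p s by rewrite E mem_head.
rewrite -E -[1%N]/(size [:: x]); apply: uniq_leq_size.
  exact: filter_uniq.
move=> y; move: xl; rewrite !mem_filter inE => /andP[? ?] /andP[? ?].
by apply/eqP/px.
Qed.

(** Volumes are compared by counting points of a grid whose step [h] is at most every radius: a cube
    of radius [r] contains at least [(r / h) ^+ n] of them, distinct cubes share none, and there are
    [M.+1 ^ n] in all. *)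
Lemma sum_disjoint_cubes_le (R : realType) (n : nat) (c0 : 'I_n -> R) (R0 : R)
    (s : seq (('I_n -> R) * R)) : 0 < R0 -> uniq s ->
  (forall v, v \in s -> 0 < v.2 /\
     forall i, c0 i - R0 <= v.1 i - v.2 /\ v.1 i + v.2 <= c0 i + R0) ->
  (forall u v, u \in s -> v \in s ->
     ccube u.1 u.2 `&` ccube v.1 v.2 !=set0 -> u = v) ->
  \sum_(v <- s) v.2 ^+ n <= (4 * R0) ^+ n.
Proof.
move=> R00 us sin sdis.
have [h [h0 hR0 hs]] : exists h : R, [/\ 0 < h, h <= R0 &
    forall v, v \in s -> h <= v.2].
  elim: {us sdis} s sin => [|v s ih] sin; first by exists R0.
  have [|h [h0 hR hs]] := ih.
    by move=> u us; apply: sin; rewrite inE us orbT.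
  have [v0 _] := sin v (mem_head _ _).
  exists (Num.min h v.2); split.
  - by rewrite lt_min h0.
  - by rewrite ge_min hR.
  - by move=> u; rewrite inE => /predU1P[->|/hs]; rewrite ge_min ?lexx ?orbT// => ->.
pose M := (Num.truncn (2 * R0 / h)).+1.
have Mu : 2 * R0 <= h * M%:R.
  by rewrite [leRHS]mulrC -ler_pdivrMr// ltW// truncnS_gt.
(* Origin of the constant 4: rounding up and the last endpoint add at most [2 * h <= 2 * R0] to the
   side [2 * R0]. *)
have Ml : h * M.+1%:R <= 4 * R0.
  have : (Num.truncn (2 * R0 / h))%:R <= 2 * R0 / h.
    by rewrite truncn_le// divr_ge0 ?(ltW h0)//; lra.
  rewrite ler_pdivlMr// (_ : M.+1%:R = (Num.truncn (2 * R0 / h))%:R + 2).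
    lra.
  by rewrite /M -addn2 natrD.
pose pt (g : {ffun 'I_n -> 'I_M.+1}) (i : 'I_n) := c0 i - R0 + h * (g i : nat)%:R.
pose S (v : ('I_n -> R) * R) (g : {ffun 'I_n -> 'I_M.+1}) :=
  [forall i, `|pt g i - v.1 i| <= v.2].
have cS v : v \in s -> v.2 ^+ n <= h ^+ n * #|S v|%:R.
  move=> vs; have [v0 vin] := sin v vs.
  pose L i := [pred k : 'I_M.+1 | `|c0 i - R0 + h * (k : nat)%:R - v.1 i| <= v.2].
  (* The grid points of a cube form a product of the one-dimensional sets [L i]. *)
  have -> : #|S v| = (\prod_(i < n) #|L i|)%N.
    rewrite -big_enum -(big_map (fun i => #|L i|) xpredT id) -foldrE.
    by rewrite -card_family; apply: eq_card.
  rewrite natr_prod -[h ^+ n](_ : \prod_(i < n) h = _); last first.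
    by rewrite prodr_const card_ord.
  rewrite -big_split/= -[v.2 ^+ n](_ : \prod_(i < n) v.2 = _); last first.
    by rewrite prodr_const card_ord.
  apply: ler_prod => i _; rewrite (ltW v0)/=.
  have [? ?] := vin i.
  by apply: card_lattice_interval => //; [exact: hs|lra].
(* Double counting: by disjointness each grid point belongs to at most one [S v]. *)
have sumS : (\sum_(v <- s) #|S v| <= M.+1 ^ n)%N.
  have -> : (M.+1 ^ n = #|{: {ffun 'I_n -> 'I_M.+1}}|)%N by rewrite card_ffun !card_ord.
  rewrite (eq_bigr (fun v => \sum_g (S v g : nat))%N); last first.
    by move=> v _; rewrite -sum1_card big_mkcond.
  rewrite exchange_big/= -sum1_card; apply: leq_sum => g _.
  rewrite -[X in (X <= _)%N](_ : count (S^~ g) s = _); last first.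
    by rewrite -sum1_count big_mkcond; apply: eq_bigr => v _ /=; case: (S v g).
  apply: count_le1 => // u v us' vs /forallP Su /forallP Sv.
  by apply: sdis => //; exists (pt g).
apply: (@le_trans _ _ (\sum_(v <- s) h ^+ n * #|S v|%:R)).
  by rewrite big_seq [leRHS]big_seq; exact: ler_sum.
rewrite -mulr_sumr -natr_sum.
apply: (@le_trans _ _ (h ^+ n * (M.+1 ^ n)%:R)).
  by rewrite ler_pM2l ?exprn_gt0// ler_nat.
rewrite natrX -exprMn; apply: lerXn2r => //; rewrite nnegrE.
  by rewrite mulr_ge0// ltW.
by rewrite mulr_ge0// ltW.
Qed.

(** * The Vitali covering theorem *)

(** The sum is the supremum of its finite partial sums; a finite [F] coming within [delta] of it
    leaves less than [delta] outside. *)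
Lemma esum_small_tail (R : realType) (T : choiceType) (D : set T)
    (a : T -> \bar R) (delta : R) : (forall i, D i -> 0 <= a i)%E ->
  (\esum_(i in D) a i < +oo)%E -> 0 < delta ->
  exists F : set T, [/\ finite_set F, F `<=` D &
    (\esum_(i in D `&` ~` F) a i < delta%:E)%E].
Proof.
move=> a0 afin d0.
have S0 : (0 <= \esum_(i in D) a i)%E by exact: esum_ge0.
have Sfin : \esum_(i in D) a i \is a fin_num by rewrite ge0_fin_numE.
have : (\esum_(i in D) a i - delta%:E < \esum_(i in D) a i)%E.
  by rewrite lteBlDr// lteDl// lte_fin.
move=> /ereal_sup_gt[_ [F [finF FD] <-]] FS.
exists F; split => //.
have a0F i : i \in F -> (0 <= a i)%E by rewrite inE => /FD/a0.
have FID : F `&` D = F by exact: setIidl.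
move: FS; rewrite [X in (X - _ < _)%E](esumID F)// setIC.
rewrite FID esum_fset//.
set s := (\sum_(i \in F) a i)%E; set u := (\esum_(i in _) a i)%E.
have : (s + u <= \esum_(i in D) a i)%E.
  by rewrite [leRHS](esumID F)// [D `&` F]setIC FID esum_fset.
move=> /le_lt_trans/(_ afin).
have s0 : (0 <= s)%E by rewrite /s -esum_fset//; apply: esum_ge0 => i /FD/a0.
have u0 : (0 <= u)%E by apply: esum_ge0 => i [/a0].
move: s u s0 u0 => [s| |] [u| |]//= s0 u0 _.
by rewrite -!EFinD !lte_fin; lra.
Qed.

(** For each [k] only finitely many terms exceed [k.+1%:R^-1], and these finite sets exhaust [D]. *)
Lemma countable_esum_pos (R : realType) (T : choiceType) (D : set T)
    (a : T -> R) : (forall i, D i -> 0 < a i) ->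
  (\esum_(i in D) (a i)%:E < +oo)%E -> countable D.
Proof.
move=> a0 afin.
have -> : D = \bigcup_k (D `&` [set i | k.+1%:R^-1 < a i]).
  apply/seteqP; split => [i Di|i [k _ []]//].
  exists (Num.truncn (a i)^-1) => //; split => //=.
  by rewrite invf_plt ?posrE ?a0// truncnS_gt.
apply: bigcup_countable => // k _; apply: finite_set_countable.
apply: contrapT => infD.
have S0 : (0 <= \esum_(i in D) (a i)%:E)%E.
  by apply: esum_ge0 => i Di; rewrite lee_fin ltW// a0.
have : \esum_(i in D) (a i)%:E \is a fin_num by rewrite ge0_fin_numE.
move/fineK; set S := fine _ => SE.
have [B BD Bn] := infinite_set_fset (Num.truncn (S * k.+1%:R)).+1 infD.
have : ((\sum_(i <- B) a i)%:E <= \esum_(i in D) (a i)%:E)%E.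
  apply: ereal_sup_ubound; exists [set` B] => /=.
    by split; [exact: finite_fset|move=> i /BD[]].
  rewrite fsbig_finite/=; last exact: finite_fset.
  by rewrite set_fsetK sumEFin.
rewrite -SE lee_fin leNgt => /negP; apply.
apply: (@lt_le_trans _ _ (\sum_(i <- B) k.+1%:R^-1)); last first.
  by rewrite big_seq [leRHS]big_seq; apply: ler_sum => i /BD[_ /ltW].
rewrite big_const_seq count_predT iter_addr_0.
rewrite -[_ *+ _]mulr_natl ltr_pdivlMr//.
by apply: (lt_le_trans (truncnS_gt _)); rewrite ler_nat.
Qed.

(** The greedy selection of the Vitali theorem, by Zorn's lemma: if some elements met no member of a
    maximal [D], one of nearly largest radius among them could be added. *)
Lemma vitali_selection (R : realType) (T : Type) (V : set T) (rad : T -> R)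
    (meets : T -> T -> Prop) (M : R) :
  (forall u v, meets u v -> meets v u) -> (forall v, V v -> meets v v) ->
  (forall v, V v -> 0 < rad v <= M) ->
  exists D : set T, [/\ D `<=` V,
    (forall u v, D u -> D v -> meets u v -> u = v) &
    forall v, V v -> exists d, [/\ D d, meets v d & rad v <= 2 * rad d]].
Proof.
move=> msym mrefl radV.
(* The third clause constrains only the [v] that meet [D]; this lets it hold for the empty family
   and pass to unions of chains. *)
pose P (D : set T) := [/\ D `<=` V,
    (forall u v, D u -> D v -> meets u v -> u = v) &
    forall v, V v -> (exists d, D d /\ meets v d) ->
      exists d, [/\ D d, meets v d & rad v <= 2 * rad d]].
have [F FP Ftot|D [[DV Ddis Dgood] Dmax]] := @Zorn_bigcup T P.
  split.
  - by move=> v [X /FP[XV _ _] /XV].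
  - move=> u v [X FX Xu] [Y FY Yv].
    have [XY|YX] := Ftot _ _ FX FY.
      by have [_ + _] := FP _ FY; apply => //; exact: XY.
    by have [_ + _] := FP _ FX; apply => //; exact: YX.
  - move=> v Vv [d [[X FX Xd] md]].
    have [_ _ /(_ v Vv)[|e [Xe me re]]] := FP _ FX; first by exists d.
    by exists e; split => //; exists X.
exists D; split => // v Vv; apply: (Dgood) => //; apply: contrapT => nv.
pose W := [set w | V w /\ ~ exists d, D d /\ meets w d].
have Wv : W v by [].
have W0 : rad @` W !=set0 by exists (rad v), v.
have Wub : has_ubound (rad @` W).
  by exists M => _ [w [Vw _] <-]; have /andP[] := radV w Vw.
have supW w : W w -> rad w <= sup (rad @` W).
  by move=> Ww; apply: ub_le_sup => //; exists w.
have sup0 : 0 < sup (rad @` W).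
  by apply: lt_le_trans (supW _ Wv); have /andP[] := radV v Vv.
(* A radius above half the supremum over [W] is the origin of the factor 2. *)
have [|_ [w [Vw nw] <-] wsup] := sup_gt W0 (x := sup (rad @` W) / 2).
  lra.
apply: (Dmax (D `|` [set w])).
  split; first by left.
  move=> /(_ w)/= DD; apply: nw; exists w; split; last exact: mrefl.
  by apply: DD; right.
split.
- by move=> u [/DV//|->].
- move=> u u' [Du|->] [Du'|->]// m; first exact: Ddis.
    by exfalso; apply: nw; exists u; split => //; exact: msym.
  by exfalso; apply: nw; exists u'.
- move=> u Vu [d [Dwd md]].
  have [[e [De me]]|nu] := pselect (exists d, D d /\ meets u d).
    have [|e' [De' me' re']] := Dgood u Vu; first by exists e.
    by exists e'; split => //; left.
  case: Dwd md => [Dd|->] md; first by exfalso; apply: nu; exists d.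
  exists w; split => //; first by right.
  by have := supW u (conj Vu nu); lra.
Qed.

Lemma ccube_sep (R : realType) (n : nat) (c x : 'I_n -> R) (r : R) :
  ~ ccube c r x ->
  exists2 e, 0 < e & forall e', e' < e -> ccube x e' `&` ccube c r = set0.
Proof.
move=> /existsNP[i /negP]; rewrite -ltNge => ci.
exists (`|x i - c i| - r); first by rewrite subr_gt0.
move=> e' e'e; apply/seteqP; split => // y [/(_ i) xy /(_ i) cy].
have := ler_distD (y i) (x i) (c i).
by rewrite (distrC (x i) (y i)); lra.
Qed.

Lemma measurable_ccube (R : realType) (n : nat) (c : 'I_n -> R) (r : R) :
  0 < r -> measurable (ccube c r : set (Rn R n)).
Proof. by move=> r0; apply: sub_sigma_algebra; exists c, r. Qed.

(** Given finitely many selected cubes, a point [x] of [A] outside all selected cubes has a small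
    cube of [V] missing them. That cube meets another selected cube, of at least half its radius, so
    the triangle inequality puts [x] in the threefold dilation of the latter. The dilated cubes have
    finite total volume, so their tails are arbitrarily small. *)
Lemma vitali_covering (R : realType) (n : nat) (A : set ('I_n -> R))
    (V : set (('I_n -> R) * R)) (c0 : 'I_n -> R) (R0 : R) :
  0 < R0 -> A `<=` ccube c0 R0 -> (forall v, V v -> 0 < v.2) ->
  (forall x, A x -> forall e : R, 0 < e -> exists2 r : R, r < e & V (x, r)) ->
  exists (I : set nat) (v : nat -> ('I_n -> R) * R) (Z : set (Rn R n)),
    [/\ forall k, I k -> V (v k),
        trivIset I (fun k => ccube (v k).1 (v k).2),
        measurable Z, lebesgue_null Z &
        A `<=` (\bigcup_(k in I) ccube (v k).1 (v k).2) `|` Z].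
Proof.
move=> R00 AR Vpos Vfine.
(* Radii below 1 and centres in [A] keep all cubes inside the cube of radius [R0 + 1], which bounds
   the total volume of a disjoint family. *)
pose V' := [set v | [/\ V v, A v.1 & v.2 < 1]].
pose meets (u v : ('I_n -> R) * R) := ccube u.1 u.2 `&` ccube v.1 v.2 !=set0.
have [|||D [DV Ddis Dgood]] := @vitali_selection R _ V' snd meets 1.
- by move=> u v; rewrite /meets setIC.
- move=> v [Vv _ _]; exists v.1; split => i; rewrite subrr normr0 ltW//; exact: Vpos.
- by move=> v [Vv _ /ltW ->]; rewrite Vpos.
have Dpos v : D v -> 0 < v.2 by move=> /DV[/Vpos].
have esumD (k : R) : 0 < k -> (\esum_(v in D) ((k * v.2) ^+ n)%:E < +oo)%E.
  move=> k0; apply: (@le_lt_trans _ _ ((k * (4 * (R0 + 1))) ^+ n)%:E); last exact: ltry.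
  apply: ge_ereal_sup => _ [F [finF FD] <-].
  rewrite fsbig_finite//= sumEFin lee_fin.
  under eq_bigr do rewrite exprMn.
  rewrite -mulr_sumr exprMn ler_pM2l ?exprn_gt0//.
  have FF v : v \in fset_set F -> D v by rewrite in_fset_set// inE => /FD.
  apply: (@sum_disjoint_cubes_le _ _ c0).
  - lra.
  - exact: fset_uniq.
  - move=> v /FF Dv; split; first exact: Dpos.
    move=> i; have [_ /AR /(_ i) + v1] := DV _ Dv.
    by rewrite ler_norml => /andP[? ?]; split; lra.
  - by move=> u v /FF Du /FF Dv; exact: Ddis.
have cD : countable D.
  apply: (@countable_esum_pos _ _ _ (fun v => (1 * v.2) ^+ n)).
    by move=> v Dv; rewrite mul1r exprn_gt0// Dpos.
  exact: esumD.
have /countable_injP[f finj] := cD.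
pose v k := xget (c0, 1) [set d | D d /\ f d = k].
have vf d : D d -> v (f d) = d.
  move=> Dd; rewrite /v; case: xgetP => [_ -> [De] fe|/(_ d)]; last by case.
  by apply: finj => //; rewrite inE.
have tails m : exists F, [/\ finite_set F, F `<=` D &
    (\esum_(i in D `&` ~` F) ((2 * (3 * i.2)) ^+ n)%:E < (m.+1%:R^-1 : R)%:E)%E].
  apply: esum_small_tail => //.
    by move=> i Di; rewrite lee_fin exprn_ge0// !mulr_ge0// ltW// Dpos.
  under eq_esum do rewrite mulrA; exact: esumD.
move/choice : tails => [F FP].
(* The points lying, for every [m], in a tripled cube of the [m]-th tail. *)
pose Z : set (Rn R n) :=
  \bigcap_m \bigcup_(k in f @` (D `&` ~` F m)) ccube (v k).1 (3 * (v k).2).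
exists (f @` D), v, Z; split.
- by move=> _ [d Dd <-]; rewrite vf//; have [] := DV _ Dd.
- by move=> _ _ [d Dd <-] [e De <-]; rewrite !vf// => /(Ddis _ _ Dd De) ->.
- apply: bigcapT_measurable => m; apply: bigcup_measurable => _ [d [Dd _] <-].
  by apply: measurable_ccube; rewrite vf// mulr_gt0// Dpos.
- move=> delta d0.
  pose m := Num.truncn delta^-1.
  exists (f @` (D `&` ~` F m)), (fun k => (v k).1), (fun k => 3 * (v k).2); split.
    by move=> _ [d [Dd _] <-]; rewrite vf// mulr_gt0// Dpos.
  split; first by move=> x /(_ m); exact.
  rewrite esum_image; last first.
    by move=> d e; rewrite !inE => -[Dd _] [De _]; apply: finj; rewrite inE.
  have [_ _] := FP m.
  under [X in _ -> (X < _)%E]eq_esum => d [Dd _] do rewrite vf//.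
  move/lt_trans; apply; rewrite lte_fin invf_plt ?posrE//.
  exact: truncnS_gt.
- move=> x Ax.
  have [?|nx] := pselect ((\bigcup_(k in f @` D) ccube (v k).1 (v k).2) x); [by left|right].
  move=> m _.
  have [finF FD _] := FP m.
  have [e e0 eF] : exists2 e : R, 0 < e & forall d, d \in (fset_set (F m) : seq _) ->
      forall e', e' < e -> ccube x e' `&` ccube d.1 d.2 = set0.
    have : {subset (fset_set (F m) : seq _) <= D}.
      by move=> d; rewrite in_fset_set// !inE => /FD.
    move: (fset_set (F m) : seq _); elim=> [|d s ih] sD; first by exists 1.
    have [|e e0 es] := ih; first by move=> u us; apply: sD; rewrite inE us orbT.
    have Dd : D d by apply/set_mem/sD; rewrite mem_head.
    have [|e1 e10 e1d] := @ccube_sep _ _ d.1 x d.2.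
      by move=> dx; apply: nx; exists (f d); [exists d|rewrite vf].
    exists (Num.min e e1); first by rewrite lt_min e0.
    move=> u + e'; rewrite lt_min inE => /predU1P[->|us] /andP[]; last by move=> ? _; exact: es.
    by move=> _; exact: e1d.
  (* The bound 1 puts [(x, r)] in [V']; the bound [e] makes its cube miss those of [F m], so that
     the selected cube it meets belongs to the tail. *)
  have [|r rm Vr] := Vfine x Ax (Num.min e 1); first by rewrite lt_min e0/=.
  move: rm; rewrite lt_min => /andP[re r1].
  have [|d [Dd md rd]] := Dgood (x, r); first by [].
  exists (f d).
    exists d => //; split => // Fd.
    have := eF d; rewrite in_fset_set// inE => /(_ Fd r re) E.
    by move: md; rewrite /meets /= E => -[].
  rewrite vf// => i.
  case: md => y [/(_ i)/= xy /(_ i) dy].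
  have := ler_distD (y i) (x i) (d.1 i).
  by rewrite (distrC (x i) (y i)); move: rd => /=; lra.
Qed.

(** * Outer regularity *)

Lemma finite_lower_bound (R : realType) (I : finType) (g : I -> R) :
  (forall i, 0 < g i) -> exists2 e, 0 < e & forall i, e <= g i.
Proof.
move=> g0; exists (\big[Num.min/1]_i g i).
  by apply/lt_bigmin.
by move=> i; exact: bigmin_le_cond.
Qed.

(** A maximum of finitely many numbers, obtained from [finite_lower_bound] applied to inverses. *)
Lemma coord_upper_bound (R : realType) (n : nat) (x : 'I_n -> R) (s : R) :
  exists m : nat, forall j, `|x j| + `|s| <= m.+1%:R.
Proof.
have pos j : 0 < `|x j| + `|s| + 1 by rewrite ltr_pwDr// addr_ge0.
have [e e0 ex] : exists2 e, 0 < e & forall j, e <= (`|x j| + `|s| + 1)^-1.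
  by apply: finite_lower_bound => j; rewrite invr_gt0.
exists (Num.truncn e^-1) => j.
apply: le_trans (ltW (truncnS_gt _)).
apply: (@le_trans _ _ (`|x j| + `|s| + 1)); first by rewrite lerDl.
by rewrite -[leLHS]invrK lef_pV2 ?ex// posrE// invr_gt0.
Qed.

(** The half-space is exhausted by cubes of growing radius that keep one face on the hyperplane
    [x i = s]. *)
Lemma measurable_coord_le (R : realType) (n : nat) (i : 'I_n) (s : R) :
  measurable ([set x | x i <= s] : set (Rn R n)).
Proof.
rewrite (_ : [set x | _] = \bigcup_(m : nat)
    ccube (fun j => if j == i then s - m.+1%:R else 0) m.+1%:R).
  by apply: bigcup_measurable => m _; exact: measurable_ccube.
apply/seteqP; split => [x /= xs|x [m _ /(_ i)]]; last first.
  by rewrite eqxx /= ler_norml => /andP[_]; lra.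
have [m xm] := coord_upper_bound x s; exists m => // j.
have := xm j; have := normr_ge0 s; have := ler_norm s.
have [->|_] := eqVneq j i; rewrite ?subr0; last lra.
have := ler_norm (- x i); rewrite normrN ler_norml => *.
by apply/andP; split; lra.
Qed.

Lemma measurable_coord_ge (R : realType) (n : nat) (i : 'I_n) (s : R) :
  measurable ([set x | s <= x i] : set (Rn R n)).
Proof.
rewrite (_ : [set x | _] = \bigcup_(m : nat)
    ccube (fun j => if j == i then s + m.+1%:R else 0) m.+1%:R).
  by apply: bigcup_measurable => m _; exact: measurable_ccube.
apply/seteqP; split => [x /= xs|x [m _ /(_ i)]]; last first.
  by rewrite eqxx /= ler_norml => /andP[]; lra.
have [m xm] := coord_upper_bound x s; exists m => // j.
have := xm j; have := normr_ge0 s; have := ler_norm (- s); rewrite normrN.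
have [->|_] := eqVneq j i; rewrite ?subr0; last lra.
have := ler_norm (x i); rewrite ler_norml => *.
by apply/andP; split; lra.
Qed.

Lemma measurable_coord_itv (R : realType) (n : nat) (i : 'I_n) (a b : R) :
  measurable ([set x | a < x i < b] : set (Rn R n)).
Proof.
rewrite (_ : [set x | _] = ~` [set x | x i <= a] `&` ~` [set x | b <= x i]).
  apply: measurableI; apply: measurableC.
    exact: measurable_coord_le.
  exact: measurable_coord_ge.
apply/seteqP; split => x /=.
  by move=> /andP[? ?]; split; apply/negP; rewrite -ltNge.
by move=> [/negP + /negP]; rewrite -!ltNge => -> ->.
Qed.

Definition ocube (R : realType) (n : nat) (c : 'I_n -> R) (r : R)
  : set ('I_n -> R) := [set x | forall i : 'I_n, `|x i - c i| < r].

Lemma measurable_ocube (R : realType) (n : nat) (c : 'I_n -> R) (r : R) :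
  measurable (ocube c r : set (Rn R n)).
Proof.
rewrite (_ : ocube c r = \bigcap_(i in [set: 'I_n]) [set x | c i - r < x i < c i + r]).
  by apply: fin_bigcap_measurable => // i _; exact: measurable_coord_itv.
apply/seteqP; split => [x xc i _|x xc i] /=.
  by have := xc i; rewrite ltr_norml => /andP[? ?]; apply/andP; split; lra.
by have /= := xc i I; rewrite ltr_norml => /andP[? ?]; apply/andP; split; lra.
Qed.

(* Openness for the sup norm; [Rn R n] carries no topology. *)
Definition cube_open (R : realType) (n : nat) (U : set ('I_n -> R)) :=
  forall x, U x -> exists2 r0, 0 < r0 & forall r, r < r0 -> ccube x r `<=` U.

Lemma cube_open_ocube (R : realType) (n : nat) (c : 'I_n -> R) (r : R) :
  cube_open (ocube c r).
Proof.
move=> x xc.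
have [e e0 ex] : exists2 e, 0 < e & forall i, e <= r - `|x i - c i|.
  by apply: finite_lower_bound => i; rewrite subr_gt0.
exists e => // r' r'e y xy i.
have := ler_distD (x i) (y i) (c i).
by have := xy i; have := ex i; lra.
Qed.

Lemma cube_openC_ccube (R : realType) (n : nat) (c : 'I_n -> R) (r : R) :
  cube_open (~` ccube c r).
Proof.
move=> x /ccube_sep[e e0 xe]; exists e => // r' /xe E y xy cy.
by have : set0 y by rewrite -E.
Qed.

Lemma cube_open_bigcup (R : realType) (n : nat) (U : nat -> set ('I_n -> R)) :
  (forall k, cube_open (U k)) -> cube_open (\bigcup_k U k).
Proof.
move=> oU x [k _ /oU[e e0 eU]]; exists e => // r /eU rU.
by apply: (subset_trans rU); exact: bigcup_sup.
Qed.

Lemma cube_open_bigcap_lt (R : realType) (n : nat) (U : nat -> set ('I_n -> R)) m :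
  (forall k, cube_open (U k)) -> cube_open (\bigcap_(k in `I_m) U k).
Proof.
move=> oU; elim: m => [x _|m ih x Ux].
  by exists 1 => // r _ y _ k.
have [|e e0 eU] := ih x; first by move=> k /= km; apply: Ux => /=; exact: ltnW.
have [|e' e'0 e'U] := oU m x; first by apply: Ux => /=.
exists (Num.min e e'); first by rewrite lt_min e0.
move=> r; rewrite lt_min => /andP[re re'] y xy k /=.
rewrite ltnS leq_eqVlt => /predU1P[->|km]; first exact: e'U xy.
exact: eU xy _ km.
Qed.

Lemma measure_bigcap_lt d (T : measurableType d) (R : realType)
    (mu : {measure set T -> \bar R}) (F : nat -> set T) (delta : \bar R) :
  (mu (F 0%N) < +oo)%E -> (forall k, measurable (F k)) ->
  {homo F : n m / (n <= m)%N >-> (m <= n)%O} ->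
  (mu (\bigcap_k F k) < delta)%E -> exists m, (mu (F m) < delta)%E.
Proof.
move=> F0fin mF ndF muF.
have muFcvg := @nonincreasing_cvg_mu _ _ _ mu F F0fin mF (bigcapT_measurable mF) ndF.
apply: contrapT => /forallNP muFdelta.
move: muF; rewrite ltNge => /negP; apply.
rewrite -(cvg_lim _ muFcvg)//; apply: lime_ge; first by apply/cvg_ex; eexists; exact: muFcvg.
by apply: nearW => m /=; rewrite leNgt; apply/negP.
Qed.

(** Sets that can be squeezed between an open set and the complement of another one form a
    sigma-algebra containing the cubes. The formulation is symmetric in [A] and its complement, so
    closure under complements is an exchange of [U] and [V]. *)
Lemma measure_squeeze (R : realType) (n : nat)
    (mu : {measure set (Rn R n) -> \bar R}) (A : set (Rn R n)) :
  (mu setT < +oo)%E -> measurable A ->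
  forall delta : R, 0 < delta ->
  exists U V : set (Rn R n), [/\ measurable U /\ measurable V,
    cube_open U /\ cube_open V, A `<=` U, ~` A `<=` V &
    (mu (U `&` V) < delta%:E)%E].
Proof.
move=> mufin.
have fin (B : set (Rn R n)) : measurable B -> (mu B < +oo)%E.
  by move=> mB; apply: le_lt_trans mufin; apply: le_measure; rewrite ?inE.
pose G := [set A : set ('I_n -> R) | forall delta : R, 0 < delta ->
  exists U V : set (Rn R n), [/\ measurable U /\ measurable V,
    cube_open U /\ cube_open V, A `<=` U, ~` A `<=` V &
    (mu (U `&` V) < delta%:E)%E]].
apply: (@smallest_sub _ (sigma_algebra setT) (@is_cube R n) G); last first.
(* For a cube, [U] is a slightly larger open cube: the shells [F k] decrease to the empty set. *)
- move=> _ [c [r [r0 ->]]] delta d0.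
  pose F k : set (Rn R n) := ocube c (r + k.+1%:R^-1) `&` ~` ccube c r.
  have mF k : measurable (F k).
    apply: measurableI; first exact: measurable_ocube.
    by apply: measurableC; exact: measurable_ccube.
  have [|||m mum] := @measure_bigcap_lt _ _ _ mu F delta%:E _ mF.
  + exact: fin.
  + move=> a b ab; apply/subsetPset => x [xb xc]; split => // i.
    apply: (lt_le_trans (xb i)); rewrite lerD2l lef_pV2 ?posrE// ler_nat.
    by rewrite ltnS.
  + rewrite (_ : \bigcap_k F k = set0) ?measure0 ?lte_fin//.
    apply/seteqP; split => // x xF.
    have [_ xc] := xF 0%N I.
    apply: xc => i; rewrite leNgt; apply/negP => ri.
    pose m := Num.truncn (`|x i - c i| - r)^-1.
    have [/(_ i) + _] := xF m I.
    apply/negP; rewrite -leNgt -lerBrDl invf_ple ?posrE ?subr_gt0//.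
    by rewrite ltW// truncnS_gt.
  exists (ocube c (r + m.+1%:R^-1)), (~` ccube c r); split => //.
  + split; first exact: measurable_ocube.
    by apply: measurableC; exact: measurable_ccube.
  + by split; [exact: cube_open_ocube|exact: cube_openC_ccube].
  + by move=> x xc i; apply: le_lt_trans (xc i) _; rewrite ltrDl invr_gt0.
split.
- move=> delta d0; exists set0, setT; split => //.
  + by split => // x _; exists 1.
  + by rewrite set0I measure0 lte_fin.
- move=> B GB delta /GB[U [V [[mU mV] [oU oV] BU BV UV]]].
  exists V, U; split => //.
  + by rewrite setTD.
  + by rewrite setTD setCK.
  + by rewrite setIC.
- move=> F GF delta d0.
  (* Halving [delta] leaves room for the final strict inequality. *)
  have d2 k : 0 < delta / 2 / (2 ^ k.+1)%:R by rewrite !divr_gt0// ltr0n expn_gt0.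
  have /choice[U /choice[V UV]] := fun k => GF k _ (d2 k).
  have mU k : measurable (U k) by have [[]] := UV k.
  have mV k : measurable (V k) by have [[]] := UV k.
  have oU k : cube_open (U k) by have [_ []] := UV k.
  have oV k : cube_open (V k) by have [_ []] := UV k.
  have mUU : measurable (\bigcup_k U k) by exact: bigcup_measurable.
  have mW m : measurable (\bigcap_(k in `I_m) V k).
    by apply: fin_bigcap_measurable => //; exact: finite_II.
  have mUW m : measurable (\bigcup_k U k `&` \bigcap_(k in `I_m) V k) by exact: measurableI.
  (* An infinite intersection of the [V k] may fail to be open; continuity from above yields a
     finite one that suffices. *)
  have [|||m mum] := @measure_bigcap_lt _ _ _ mu
      (fun m => \bigcup_k U k `&` \bigcap_(k in `I_m) V k) delta%:E _ mUW.
  + exact: fin.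
  + move=> a b ab; apply/subsetPset => x [xU xV]; split => // k /= ka.
    by apply: xV => /=; exact: leq_trans ka ab.
  + apply: (@le_lt_trans _ _ (mu (\bigcup_k (U k `&` V k)))).
      apply: le_measure; rewrite ?inE.
      * by apply: bigcapT_measurable => m; exact: measurableI.
      * by apply: bigcup_measurable => k _; exact: measurableI.
      * move=> x xUV; have [[k _ Ux] _] := xUV 0%N I.
        by exists k => //; split => //; have [_ /(_ k)] := xUV k.+1 I; apply => /=.
    apply: (@le_lt_trans _ _ (\sum_(0 <= k <oo) mu (U k `&` V k))%E).
      apply: measure_sigma_subadditive => //.
        by move=> k; exact: measurableI.
      by apply: bigcup_measurable => k _; exact: measurableI.
    apply: (@le_lt_trans _ _ (\sum_(0 <= k <oo) (0 + (delta / 2 / (2 ^ k.+1)%:R)%:E))%E).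
      apply: lee_nneseries => // k _.
      by rewrite add0e; have [_ _ _ _ /ltW] := UV k.
    apply: le_lt_trans (epsilon_trick _ _ _) _ => //; first lra.
    by rewrite eseries0// add0e lte_fin; lra.
  exists (\bigcup_k U k), (\bigcap_(k in `I_m) V k); split => //.
  + by split; [exact: cube_open_bigcup|exact: cube_open_bigcap_lt].
  + by move=> x [k _ Fx]; exists k => //; have [_ _ + _ _] := UV k; apply.
  + move=> x nFx k _; have [_ _ _ + _] := UV k; apply => Fx.
    by apply: nFx; exists k.
Qed.

(** Outside [A], the open set [U] of [measure_squeeze] lies in the small set [U]&[V]. *)
Lemma outer_regularity (R : realType) (n : nat)
    (mu : {measure set (Rn R n) -> \bar R}) (A : set (Rn R n)) (delta : R) :
  (mu setT < +oo)%E -> measurable A -> 0 < delta ->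
  exists U : set (Rn R n), [/\ measurable U, cube_open U, A `<=` U &
    (mu U <= mu A + delta%:E)%E].
Proof.
move=> mufin mA d0.
have [U [V [[mU mV] [oU _] AU AV UV]]] := measure_squeeze mufin mA d0.
exists U; split => //.
apply: (@le_trans _ _ (mu (A `|` (U `&` V)))).
  apply: le_measure; rewrite ?inE//.
    by apply: measurableU => //; exact: measurableI.
  by move=> x Ux; have [Ax|/AV Vx] := pselect (A x); [left|right].
apply: le_trans (measureU2 _ _ _) _ => //; first exact: measurableI.
by rewrite leeD2l// ltW.
Qed.

(** * Density points *)

(** The product form makes cubes of measure zero count as sparse, in accordance with
    [density_point], which asks for positive measure. The set is only ever handled through
    measurable supersets. *)
Definition sparse_points (R : realType) (n : nat)
    (mu : {measure set (Rn R n) -> \bar R}) (N : set (Rn R n)) (eta : R) :=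
  [set x | N x /\ forall e : R, 0 < e -> exists2 r : R, 0 < r < e &
    (mu (N `&` ccube x r) <= (1 - eta)%:E * mu (ccube x r))%E].

Lemma le_measure_bigcup_scale d (T : measurableType d) (R : realType)
    (mu : {measure set T -> \bar R}) (I : set nat) (F G : nat -> set T) (c : R) :
  0 <= c -> (forall k, I k -> measurable (F k)) ->
  (forall k, I k -> measurable (G k)) -> trivIset I G ->
  (forall k, I k -> F k `<=` G k) ->
  (forall k, I k -> (mu (F k) <= c%:E * mu (G k))%E) ->
  (mu (\bigcup_(k in I) F k) <= c%:E * mu (\bigcup_(k in I) G k))%E.
Proof.
move=> c0 mF mG tG FG muFG.
rewrite !measure_bigcup//; last first.
  move=> i j Ii Ij [x [Fx Gx]]; apply: (tG i j Ii Ij).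
  by exists x; split; exact: FG.
rewrite -nneseriesZl//; apply: lee_nneseries => // k.
by rewrite inE => /muFG.
Qed.

(** The Vitali theorem is applied to the cubes inside [U] in which [N] has low density. The traces
    of [N] on the disjoint cubes obtained cover the sparse points up to a Lebesgue null set, to
    which [mu] gives no mass. *)
Lemma sparse_cover (R : realType) (n : nat)
    (mu : {measure set (Rn R n) -> \bar R}) (N : set (Rn R n)) (eta : R)
    (c0 : 'I_n -> R) (R0 : R) (U : set (Rn R n)) :
  abs_cont_lebesgue mu -> measurable N -> 0 < eta < 1 -> 0 < R0 ->
  N `<=` ccube c0 R0 -> measurable U -> cube_open U ->
  sparse_points mu N eta `<=` U ->
  exists M : set (Rn R n), [/\ measurable M, sparse_points mu N eta `<=` M &
    (mu M <= (1 - eta)%:E * mu U)%E].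
Proof.
move=> Hac mN /andP[eta0 eta1] R00 NR mU oU NU.
pose V := [set v : ('I_n -> R) * R | [/\ 0 < v.2, ccube v.1 v.2 `<=` U &
  (mu (N `&` ccube v.1 v.2) <= (1 - eta)%:E * mu (ccube v.1 v.2))%E]].
have [||x Ax e e0|I [v [Z [VI tI mZ Z0 AZ]]]] :=
  @vitali_covering R n (sparse_points mu N eta) V c0 R0 R00.
- by move=> x [/NR].
- by move=> u [].
- have [e1 e10 e1U] := oU x (NU x Ax).
  have [|r /andP[r0]] := Ax.2 (Num.min e e1); first by rewrite lt_min e0.
  by rewrite lt_min => /andP[re re1] xr; exists r => //; split => //; exact: e1U.
have mQ k : I k -> measurable (ccube (v k).1 (v k).2 : set (Rn R n)).
  by move=> /VI[? _ _]; exact: measurable_ccube.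
have mNQ k : I k -> measurable (N `&` ccube (v k).1 (v k).2 : set (Rn R n)).
  by move=> Ik; apply: measurableI => //; exact: mQ.
exists (\bigcup_(k in I) (N `&` ccube (v k).1 (v k).2) `|` Z); split.
- by apply: measurableU => //; exact: bigcup_measurable.
- move=> x Ax; have [[k Ik kx]|] := AZ x Ax; last by right.
  by left; exists k => //; split => //; have [] := Ax.
apply: (@le_trans _ _ (mu (\bigcup_(k in I) (N `&` ccube (v k).1 (v k).2)) + mu Z)%E).
  by apply: measureU2 => //; exact: bigcup_measurable.
rewrite (Hac _ mZ Z0) adde0.
apply: (@le_trans _ _ ((1 - eta)%:E * mu (\bigcup_(k in I) ccube (v k).1 (v k).2))%E).
  apply: le_measure_bigcup_scale => //; first by rewrite subr_ge0 ltW.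
  by move=> k /VI[_ _].
apply: lee_wpmul2l; first by rewrite lee_fin subr_ge0 ltW.
apply: le_measure; rewrite ?inE//.
  exact: bigcup_measurable.
by apply: bigcup_sub => k /VI[].
Qed.

(** If the infimum of the measures of measurable covers were positive, [sparse_cover] inside an open
    set of nearly minimal measure would produce a cover below it. *)
Lemma sparse_points_null (R : realType) (n : nat)
    (mu : {measure set (Rn R n) -> \bar R}) (N : set (Rn R n)) (eta : R)
    (c0 : 'I_n -> R) (R0 : R) :
  (mu setT < +oo)%E ->
  abs_cont_lebesgue mu -> measurable N -> 0 < eta < 1 -> 0 < R0 ->
  N `<=` ccube c0 R0 -> forall e : R, 0 < e ->
  exists M : set (Rn R n), [/\ measurable M, sparse_points mu N eta `<=` M &
    (mu M < e%:E)%E].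
Proof.
move=> mufin Hac mN /[dup] eta01 /andP[eta0 eta1] R00 NR e e0.
have mfin (A : set (Rn R n)) : measurable A -> mu A = (fine (mu A))%:E.
  move=> mA; rewrite fineK// ge0_fin_numE//; apply: le_lt_trans mufin.
  by apply: le_measure; rewrite ?inE.
pose S := [set y : R | exists M : set (Rn R n), [/\ measurable M,
  sparse_points mu N eta `<=` M & y = fine (mu M)]].
have SN : S !=set0.
  by exists (fine (mu N)), N; split => // x [].
have Sinf : has_inf S.
  by split => //; exists 0 => _ [M [_ _ ->]]; exact: fine_ge0.
have [m0|m0] := leP (inf S) 0.
  have [_ [M [mM sM ->]] Me] := inf_adherent e0 Sinf.
  exists M; split => //; rewrite mfin// lte_fin.
  by apply: lt_le_trans Me _; rewrite gerDr.
(* The cover and the open set each lose [d], and this choice makes [(1 - eta) * (inf S + 2 * d)]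
   smaller than [inf S]. *)
pose d := eta * inf S / 4.
have d0 : 0 < d by rewrite /d !mulr_gt0// invr_gt0.
have [_ [M [mM sM ->]] Me] := inf_adherent d0 Sinf.
have [U [mU oU MU muU]] := outer_regularity mufin mM d0.
have [M' [mM' sM' muM']] := sparse_cover Hac mN eta01 R00 NR mU oU (subset_trans sM MU).
have mM'S : inf S <= fine (mu M').
  by apply: ge_inf; [have [] := Sinf|exists M'].
move: muM' muU; rewrite (mfin M')// (mfin U)// (mfin M)// -EFinM -EFinD !lee_fin => cb ba.
have bd : (1 - eta) * fine (mu U) <= (1 - eta) * (inf S + 2 * d).
  by rewrite ler_pM2l ?subr_gt0//; lra.
have ed : 0 < eta * d by rewrite mulr_gt0.
have dE : eta * inf S = 4 * d by rewrite /d [RHS]mulrC divfK.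
clearbody d.
have : (1 - eta) * (inf S + 2 * d) < inf S by lra.
by rewrite ltNge (le_trans mM'S (le_trans cb bd)).
Qed.

(** A point of [N] that is not a density point is sparse at some level [eta k], so countably many
    sets of outer measure zero cover [N]. *)
Lemma density_null (R : realType) (n : nat)
    (mu : {measure set (Rn R n) -> \bar R}) (N : set (Rn R n))
    (c0 : 'I_n -> R) (R0 : R) :
  (mu setT < +oo)%E ->
  abs_cont_lebesgue mu -> measurable N -> 0 < R0 ->
  N `<=` ccube c0 R0 -> (forall x, N x -> ~ density_point mu N x) ->
  mu N = 0%E.
Proof.
move=> mufin Hac mN R00 NR Nd.
have mfin (A : set (Rn R n)) : measurable A -> mu A = (fine (mu A))%:E.
  move=> mA; rewrite fineK// ge0_fin_numE//; apply: le_lt_trans mufin.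
  by apply: le_measure; rewrite ?inE.
(* The shift by 2 keeps every level strictly below 1. *)
pose eta k : R := k.+2%:R^-1.
have eta01 k : 0 < eta k < 1.
  by rewrite invr_gt0 ltr0n/= invf_lt1 ?ltr0n// ltr1n.
have Nbad x : N x -> exists k, sparse_points mu N (eta k) x.
  move=> Nx; have /existsNP[e /not_implyP[e0 /forallNP ne]] := Nd x Nx.
  pose k := Num.truncn e^-1.
  have ke : eta k <= e.
    rewrite invf_ple ?posrE// ltW// (lt_trans (truncnS_gt _))// ltr_nat.
    by rewrite ltnS.
  exists k; split => // r0 r00.
  have /not_andP[//|/existsNP[r /not_implyP[rp /not_implyP[rr0 nr]]]] := ne r0.
  exists r; first by rewrite rp.
  have mQ : measurable (ccube x r : set (Rn R n)) by exact: measurable_ccube.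
  have mNQ : measurable (N `&` ccube x r : set (Rn R n)) by exact: measurableI.
  have le1 : (mu (N `&` ccube x r) <= mu (ccube x r))%E.
    by apply: le_measure; rewrite ?inE.
  move: nr le1; rewrite (mfin _ mQ) (mfin _ mNQ) -EFinM !lee_fin lte_fin ltry.
  set a := fine (mu (N `&` _)); set q := fine _.
  have a0 : 0 <= a by exact: fine_ge0.
  move=> nr aq; have [q0|q0] := leP q 0.
    have -> : a = 0 by lra.
    have -> : q = 0 by lra.
    by rewrite mulr0.
  have : e <= `|a / q - 1|.
    by rewrite leNgt; apply/negP => lte; apply: nr.
  rewrite distrC ger0_norm; last by rewrite subr_ge0 ler_pdivrMr// mul1r.
  rewrite lerBrDr -lerBrDl ler_pdivrMr// => /le_trans; apply.
  by rewrite ler_pM2r// lerD2l lerN2.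
apply/eqP; rewrite eq_le measure_ge0 andbT; apply/lee_addgt0Pr => e e0.
have e2 k : 0 < e / (2 ^ k.+1)%:R by rewrite divr_gt0// ltr0n expn_gt0.
have /choice[M MP] := fun k => sparse_points_null mufin Hac mN (eta01 k) R00 NR (e2 k).
apply: (@le_trans _ _ (\sum_(0 <= k <oo) mu (M k))%E).
  apply: measure_sigma_subadditive => //; first by move=> k; have [] := MP k.
  by move=> x /Nbad[k kx]; exists k => //; have [_ + _] := MP k; apply.
apply: (@le_trans _ _ (\sum_(0 <= k <oo) (0 + (e / (2 ^ k.+1)%:R)%:E))%E).
  by apply: lee_nneseries => // k _; rewrite add0e ltW//; have [] := MP k.
apply: le_trans (epsilon_trick _ _ _) _ => //; first lra.
by rewrite eseries0.
Qed.

(** * Sets of prescribed measure *)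

(** The slice is covered by [N.+1 ^ n] cubes of radius [w = R0 / N%:R]; their total volume is at
    most [(4 * R0) ^+ n * (2 * w)], which is small with [w]. *)
Lemma lebesgue_null_hyperplane (R : realType) (n : nat) (i : 'I_n.+1) (s : R)
    (c0 : 'I_n.+1 -> R) (R0 : R) : 0 < R0 ->
  lebesgue_null (ccube c0 R0 `&` [set x | x i = s]).
Proof.
move=> R00 delta d0.
pose m := Num.truncn ((4 * R0) ^+ n * (2 * R0) / delta).
pose N := m.+1; pose w := R0 / N%:R.
have N0 : (0 : R) < N%:R by rewrite ltr0n.
have w0 : 0 < w by rewrite divr_gt0.
have wN : w * N%:R = R0 by rewrite divfK// gt_eqF.
(* The centre has [i]-th coordinate [s] and grid midpoints elsewhere. The index [N] is allowed
   because the right endpoint [c0 j + R0] falls into that cell. *)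
pose ctr (g : {ffun 'I_n -> 'I_N.+1}) (j : 'I_n.+1) : R :=
  if unlift i j is Some j' then c0 j - R0 + (2 * (g j' : nat)%:R + 1) * w else s.
pose M := #|{: {ffun 'I_n -> 'I_N.+1}}|.
pose g0 : {ffun 'I_n -> 'I_N.+1} := [ffun=> ord0].
exists `I_M, (fun k => ctr (nth g0 (enum {: {ffun 'I_n -> 'I_N.+1}}) k)), (fun=> w).
split => //; split.
- move=> x [xc /= xi].
  pose y j := (x j - c0 j + R0) / (2 * w).
  have w20 : 0 < 2 * w by rewrite mulr_gt0.
  have y0 j : 0 <= y j.
    rewrite divr_ge0 ?(ltW w20)//.
    by have := xc j; rewrite ler_norml => /andP[]; lra.
  have yN j : (Num.truncn (y j) < N.+1)%N.
    rewrite ltnS -(ler_nat R); apply: (@le_trans _ _ (y j)); first by rewrite truncn_le.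
    rewrite ler_pdivrMr// mulrCA [_ * w]mulrC wN.
    by have := xc j; rewrite ler_norml => /andP[]; lra.
  pose g : {ffun 'I_n -> 'I_N.+1} := [ffun j' => Ordinal (yN (lift i j'))].
  exists (enum_rank g) => //; first exact: ltn_ord.
  rewrite nth_enum_rank => j.
  rewrite /ctr; case: unliftP => [j' ->|->]; last by rewrite xi subrr normr0 ltW.
  rewrite ffunE/=; set j0 := lift i j'.
  have := truncnS_gt (y j0); rewrite ltr_pdivrMr// -natr1 => ?.
  have : (Num.truncn (y j0))%:R <= y j0 by rewrite truncn_le.
  by rewrite ler_pdivlMr// => ?; rewrite ler_norml; apply/andP; split; lra.
- rewrite esum_fset; [|exact: finite_II|by move=> k _; rewrite lee_fin exprn_ge0// mulr_ge0// ltW].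
  rewrite -fsbig_ord sumEFin lte_fin sumr_const card_ord /M card_ffun !card_ord.
  rewrite -[_ *+ _]mulr_natl natrX [_ * _](_ : _ = (N.+1%:R * (2 * w)) ^+ n * (2 * w)); last first.
    by rewrite [in RHS]exprMn -[RHS]mulrA -exprSr.
  apply: (@le_lt_trans _ _ ((4 * R0) ^+ n * (2 * w))).
    apply: ler_wpM2r; first by rewrite mulr_ge0// ltW.
    apply: lerXn2r; rewrite ?nnegrE.
    - by rewrite !mulr_ge0// ltW.
    - by rewrite mulr_ge0// ltW.
    rewrite -natr1 -wN; have : (1 : R) <= N%:R by rewrite ler1n.
    by nra.
  rewrite /w !mulrA ltr_pdivrMr// [X in _ < X]mulrC -ltr_pdivrMr//.
  by rewrite -mulrA; exact: truncnS_gt.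
Qed.

(** Take for [a] the supremum of the levels [s] at which [f >= s] still has measure at least [t].
    Continuity from above gives the lower bound at [a], continuity from below the upper one. This
    serves both for [f] itself and for a coordinate function. *)
Lemma quantile d (T : measurableType d) (R : realType)
    (mu : {measure set T -> \bar R}) (A : set T) (f : T -> R) (t b : R) :
  measurable A -> (mu A < +oo)%E ->
  (forall s, measurable (A `&` [set x | s <= f x])) ->
  (forall x, A x -> b <= f x) -> 0 < t -> (t%:E <= mu A)%E ->
  exists a, [/\ b <= a, (t%:E <= mu (A `&` [set x | (a <= f x)%R]))%E &
    (mu (A `&` [set x | (a < f x)%R]) <= t%:E)%E].
Proof.
move=> mA Afin mf fb t0 tA.
have fin s : (mu (A `&` [set x | (s <= f x)%R]) < +oo)%E.
  by apply: le_lt_trans Afin; apply: le_measure; rewrite ?inE.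
have mono s s' : s' <= s -> (mu (A `&` [set x | (s <= f x)%R]) <=
    mu (A `&` [set x | (s' <= f x)%R]))%E.
  move=> ss'; apply: le_measure; rewrite ?inE//.
  by move=> x [Ax /= sx]; split => //=; exact: le_trans sx.
pose S := [set s | (t%:E <= mu (A `&` [set x | (s <= f x)%R]))%E].
have Sb : S b.
  rewrite /S/= (_ : A `&` _ = A)//; apply/seteqP; split => [x []//|x Ax].
  by split => //=; exact: fb.
have Sub : has_ubound S.
  have [||m mum] := @measure_bigcap_lt _ _ _ mu
      (fun k => A `&` [set x | k%:R <= f x]) t%:E (fin _) (fun=> mf _).
  - move=> k l kl; apply/subsetPset => x [Ax /= lx]; split => //=.
    by apply: le_trans lx; rewrite ler_nat.
  - rewrite (_ : \bigcap_k _ = set0) ?measure0 ?lte_fin//.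
    apply/seteqP; split => // x xF.
    have [_ /=] := xF (Num.truncn (f x)).+1 I.
    by rewrite leNgt truncnS_gt.
  exists m%:R => s Ss; rewrite leNgt; apply/negP => /ltW /mono sm.
  by have := lt_le_trans mum (le_trans Ss sm); rewrite ltxx.
have Ssup : has_sup S by split => //; exists b.
exists (sup S); split.
- by apply: ub_le_sup.
- rewrite leNgt; apply/negP => lt.
  have [||m mum] := @measure_bigcap_lt _ _ _ mu
      (fun k => A `&` [set x | sup S - k.+1%:R^-1 <= f x]) t%:E (fin _) (fun=> mf _).
  + move=> k l kl; apply/subsetPset => x [Ax /= lx]; split => //=.
    by apply: le_trans lx; rewrite lerD2l lerN2 lef_pV2 ?posrE// ler_nat ltnS.
  + apply: le_lt_trans lt; apply: le_measure; rewrite ?inE//.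
      exact: bigcapT_measurable.
    move=> x xF; have [Ax _] := xF 0%N I; split => //=.
    rewrite leNgt; apply/negP => fx.
    have [_ /=] := xF (Num.truncn (sup S - f x)^-1) I.
    apply/negP; rewrite -ltNge ltrBrDr -ltrBrDl invf_plt ?posrE ?subr_gt0//.
    exact: truncnS_gt.
  have m0 : (0 : R) < m.+1%:R^-1 by rewrite invr_gt0.
  have [s Ss /ltW /mono sm] := sup_adherent m0 Ssup.
  by have := lt_le_trans mum (le_trans Ss sm); rewrite ltxx.
- pose G k := A `&` [set x | sup S + k.+1%:R^-1 <= f x].
  have UG : \bigcup_k G k = A `&` [set x | sup S < f x].
    apply/seteqP; split => [x [k _ [Ax /= kx]]|x [Ax /= fx]].
      by split => //=; apply: lt_le_trans kx; rewrite ltrDl.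
    exists (Num.truncn (f x - sup S)^-1) => //; split => //=.
    rewrite -lerBrDl invf_ple ?posrE ?subr_gt0//.
    by rewrite ltW// truncnS_gt.
  rewrite -UG.
  have mG k : measurable (G k) by exact: mf.
  have Gcvg := @nondecreasing_cvg_mu _ _ _ mu G mG (bigcupT_measurable _ mG).
  rewrite -(cvg_lim _ (Gcvg _))//; last first.
    move=> k l kl; apply/subsetPset => x [Ax /= lx]; split => //=.
    by apply: le_trans lx; rewrite lerD2l lef_pV2 ?posrE// ler_nat ltnS.
  apply: lime_le.
    apply/cvg_ex; eexists; apply: Gcvg.
    move=> k l kl; apply/subsetPset => x [Ax /= lx]; split => //=.
    by apply: le_trans lx; rewrite lerD2l lef_pV2 ?posrE// ler_nat ltnS.
  apply: nearW => k; rewrite leNgt; apply/negP => /ltW Sk.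
  have := ub_le_sup Sub Sk; rewrite leNgt => /negP; apply.
  by rewrite ltrDl.
Qed.

(** The set [A] is cut by a half-space in the first coordinate; since hyperplanes are null, the two
    inequalities of [quantile] become an equality. *)
Lemma exists_subset_of_measure (R : realType) (n : nat)
    (mu : {measure set (Rn R n.+1) -> \bar R}) (A : set (Rn R n.+1))
    (c0 : 'I_n.+1 -> R) (R0 t : R) :
  abs_cont_lebesgue mu -> measurable A -> (mu A < +oo)%E -> 0 < R0 ->
  A `<=` ccube c0 R0 -> 0 < t -> (t%:E <= mu A)%E ->
  exists E : set (Rn R n.+1), [/\ measurable E, E `<=` A & mu E = t%:E].
Proof.
move=> Hac mA Afin R00 AR t0 tA.
have mge s : measurable (A `&` [set x | s <= x ord0] : set (Rn R n.+1)).
  by apply: measurableI => //; exact: measurable_coord_ge.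
have [|a [_ ta at_]] :=
  @quantile _ _ _ mu A (fun x => x ord0) t (c0 ord0 - R0) mA Afin mge _ t0 tA.
  by move=> x /AR /(_ ord0); rewrite ler_norml => /andP[]; lra.
exists (A `&` [set x | a <= x ord0]); split => //.
apply/eqP; rewrite eq_le ta andbT.
have mH : measurable (A `&` [set x | x ord0 = a] : set (Rn R n.+1)).
  rewrite (_ : [set x | _] = [set x | x ord0 <= a] `&` [set x | a <= x ord0]).
    apply: measurableI => //; apply: measurableI.
      exact: measurable_coord_le.
    exact: measurable_coord_ge.
  apply/seteqP; split => [x /= ->//|x /= [xa ax]].
  by apply/eqP; rewrite eq_le xa.
have mG : measurable (A `&` [set x | a < x ord0] : set (Rn R n.+1)).
  rewrite (_ : [set x | _] = ~` [set x | x ord0 <= a]).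
    by apply: measurableI => //; apply: measurableC; exact: measurable_coord_le.
  by apply/seteqP; split => x /=; rewrite ltNge => /negP.
have H0 : mu (A `&` [set x | x ord0 = a]) = 0%E.
  apply: Hac => // delta d0.
  have [I [c [r [rI [sub small]]]]] := @lebesgue_null_hyperplane R n ord0 a c0 R0 R00 delta d0.
  exists I, c, r; split => //; split => //.
  by apply: subset_trans sub => x [/AR].
apply: le_trans at_.
apply: (@le_trans _ _
  (mu ((A `&` [set x | a < x ord0]) `|` (A `&` [set x | x ord0 = a])))).
  apply: le_measure; rewrite ?inE//; first exact: measurableU.
  move=> x [Ax /=]; rewrite le_eqVlt => /predU1P[->|]; by [right|left].
apply: (@le_trans _ _ (mu (A `&` [set x | (a < x ord0)%R]) +
    mu (A `&` [set x | x ord0 = a]))%E).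
  exact: measureU2.
by rewrite H0 adde0.
Qed.

(** * The rearrangement *)

(** The integral of a nonnegative function is a supremum over the simple functions below it. This
    allows comparing the integral of [fstar] with others without a study of its measurability. *)
Lemma le_integral_nonmeasurable d (T : measurableType d) (R : realType)
    (mu : {measure set T -> \bar R}) (D : set T) (f g : T -> \bar R) :
  (forall x, D x -> 0 <= f x)%E -> (forall x, D x -> f x <= g x)%E ->
  (\int[mu]_(x in D) f x <= \int[mu]_(x in D) g x)%E.
Proof.
move=> f0 fg; rewrite !ge0_integralE//; last first.
  by move=> x Dx; exact: le_trans (f0 x Dx) (fg x Dx).
apply: ereal_sup_le => _ [h /= hf <-]; exists h => //= x.
apply: le_trans (hf x) _; rewrite !patchE.
by case: ifPn => //; rewrite inE => /fg.
Qed.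

(** Fewer than [z / delta + 1] of the multiples [k%:R * delta] lie below a nonnegative [z]. *)
Lemma sum_levels_le (R : realType) (delta z : R) (K : nat) : 0 < delta -> 0 <= z ->
  \sum_(0 <= k < K) delta * (k%:R * delta < z)%R%:R <= delta + z.
Proof.
move=> d0 z0; elim: K => [|K ih]; first by rewrite big_geq// addr_ge0// ltW.
rewrite big_nat_recr//=; case: ltP => [Kz|_]; last by rewrite mulr0 addr0.
rewrite mulr1 addrC lerD2l; apply: le_trans (ltW Kz).
apply: (@le_trans _ _ (\sum_(0 <= k < K) delta)); last first.
  by rewrite sumr_const_nat subn0 mulr_natl.
apply: ler_sum => k _; case: ltP => _; first by rewrite mulr1.
by rewrite mulr0 ltW.
Qed.

Section rearrangement.
Context d (T : measurableType d) (R : realType).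
Variables (mu : {measure set T -> \bar R}) (f : T -> R) (Q0 : set T).
Hypotheses (mQ0 : measurable Q0) (Q0fin : (mu Q0 < +oo)%E).
Hypotheses (fint : mu.-integrable Q0 (EFin \o f)) (f0 : forall x, Q0 x -> 0 <= f x).

Lemma measurable_superlevel (s : R) : measurable (Q0 `&` [set x | s < f x]).
Proof.
have /measurable_int/measurable_EFinP mf := fint.
rewrite (_ : [set x | _] = f @^-1` `]s, +oo[%classic); first exact: mf.
by apply/seteqP; split => x /=; rewrite in_itv/= andbT.
Qed.

Lemma fstar_ge (t a : R) (E : set T) : measurable E -> E `<=` Q0 ->
  mu E = t%:E -> (forall x, E x -> a <= f x) -> (a%:E <= fstar mu f Q0 t)%E.
Proof.
move=> mE EQ muE aE; apply: le_ereal_sup_tmp; eexists; first by exists E.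
by apply: le_ereal_inf_tmp => _ [x Ex <-]; rewrite lee_fin (le_trans (aE x Ex))// ler_norm.
Qed.

(** Half of the duality between the rearrangement and the distribution function: a competitor [E]
    with infimum above [s] lies in the superlevel set. *)
Lemma fstar_gt_superlevel (t s : R) :
  (s%:E < fstar mu f Q0 t)%E -> (t%:E <= mu (Q0 `&` [set x | (s < f x)%R]))%E.
Proof.
move=> /ereal_sup_gt[_ [E [mE [EQ <-]] <-]] sE.
apply: le_measure; rewrite ?inE//; first exact: measurable_superlevel.
move=> x Ex; split; first exact: EQ.
rewrite /= -lte_fin -[f x]ger0_norm ?f0//; last exact: EQ.
by apply: (lt_le_trans sE); apply: ereal_inf_lbound; exists x.
Qed.

(** A layer-cake argument: above the level [a], the rearrangement has no larger superlevel sets than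
    [f]. Levels are discretized with a step [delta] that costs at most [delta * mu E]. *)
Lemma integral_fstar_le (a t : R) : 0 <= a -> 0 < t ->
  (forall tau, 0 < tau -> tau <= t -> (0 <= fstar mu f Q0 tau)%E) ->
  (\int[@lebesgue_measure R]_(tau in `]0%R, t]%classic) fstar mu f Q0 tau <=
   (a * t)%:E + \int[mu]_(x in Q0 `&` [set x | (a < f x)%R]) (f x - a)%:E)%E.
Proof.
move=> a0 t0 fstar0.
set E := Q0 `&` [set x | a < f x].
have mE : measurable E by exact: measurable_superlevel.
have finQ (A : set T) : measurable A -> A `<=` Q0 -> mu A = (fine (mu A))%:E.
  move=> mA AQ; rewrite fineK// ge0_fin_numE//; apply: le_lt_trans Q0fin.
  by apply: le_measure; rewrite ?inE.
have mfE : measurable_fun E (fun x => (f x - a)%:E).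
  apply/measurable_EFinP; apply: measurable_funB => //.
  have /measurable_int/measurable_EFinP := fint.
  by apply: measurable_funS => // x [].
(* Both sides are compared with the sum over [k] of [delta * mu (L k)],
   [L k] being the part of [Q0] where [f > a + k * delta]. *)
apply/lee_addgt0Pr => e e0.
(* This keeps the error [delta * mu E] below [e]; adding 1 avoids a division by zero. *)
pose delta := e / (fine (mu E) + 1).
have muE1 : 0 < fine (mu E) + 1 by rewrite ltr_wpDl// fine_ge0.
have d0 : 0 < delta by rewrite divr_gt0.
pose L k := Q0 `&` [set x | a + k%:R * delta < f x].
have mL k : measurable (L k) by exact: measurable_superlevel.
have LE k : L k `<=` E.
  by move=> x [Qx /= kx]; split => //=; apply: le_lt_trans kx; rewrite lerDl mulr_ge0// ltW.
pose m k := fine (mu (L k)).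
have m0 k : 0 <= m k by exact: fine_ge0.
have muL k : mu (L k) = (m k)%:E by apply: finQ => // x [].
(* A step majorant of [fstar]: [a] plus [delta] for each level [k] with [tau <= m k]. *)
pose G (tau : R) := (a%:E + \sum_(0 <= k <oo) (delta * \1_(`]0%R, m k]%classic) tau)%:E)%E.
have ind0 k tau : (0 <= (delta * \1_(`]0%R, m k]%classic) tau)%:E :> \bar R)%E.
  by rewrite lee_fin mulr_ge0// ltW.
have fstarG tau : (`]0%R, t]%classic) tau -> (fstar mu f Q0 tau <= G tau)%E.
  rewrite /= in_itv/= => /andP[tau0 taut].
  have GK K : (forall k, (k < K)%N -> tau <= m k) -> ((a + K%:R * delta)%:E <= G tau)%E.
    move=> tauK; rewrite EFinD leeD2l//.
    apply: le_trans (nneseries_lim_ge K _) => //.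
    rewrite sumEFin lee_fin big_nat (eq_bigr (fun=> delta)); last first.
      move=> k /andP[_ kK]; rewrite indicE mem_set ?mulr1//=.
      by rewrite in_itv/= tau0 tauK.
    by rewrite -big_nat sumr_const_nat subn0 mulr_natl.
  (* If [K] is the least index with [m K < tau], then [fstar] at [tau] is at most
     [a + K%:R * delta]. If there is no such index, the series in [G tau] diverges. *)
  have [[k0 k0tau]|nk] := pselect (exists k, m k < tau).
    have ex : exists k, (fun k => m k < tau) k by exists k0.
    case: (ex_minnP ex) => K Ktau Kmin.
    apply: le_trans (GK K _); last first.
      by move=> k kK; rewrite leNgt; apply/negP => /Kmin; rewrite leqNgt kK.
    rewrite leNgt; apply/negP => /fstar_gt_superlevel.
    by rewrite -/(L K) muL lee_fin leNgt Ktau.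
  have -> : G tau = +oo%E; last exact: leey.
  apply: eq_infty => r.
  apply: le_trans (GK (Num.truncn (r / delta)).+1 _); last first.
    by move=> k _; rewrite leNgt; apply/negP => ?; apply: nk; exists k.
  have := truncnS_gt (r / delta); rewrite ltr_pdivrMr// => rd.
  by rewrite lee_fin; lra.
apply: (@le_trans _ _ (\int[@lebesgue_measure R]_(tau in `]0%R, t]%classic) G tau)%E).
  apply: le_integral_nonmeasurable => // tau tau0t.
  by apply: fstar0; move: tau0t; rewrite /= in_itv/= => /andP[].
have mind k : measurable_fun (`]0%R, t]%classic)
    (fun tau : R => (delta * \1_(`]0%R, m k]%classic) tau)%:E).
  by apply/measurable_EFinP; apply: measurable_funM => //; exact: measurable_indic.
have -> : (\int[@lebesgue_measure R]_(tau in `]0%R, t]%classic) G tau = (a * t)%:E +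
    \int[@lebesgue_measure R]_(tau in `]0%R, t]%classic)
      \sum_(0 <= k <oo) (delta * \1_(`]0%R, m k]%classic) tau)%:E)%E.
  rewrite /G ge0_integralD//; last 2 first.
    by move=> tau _; exact: nneseries_ge0.
    apply: ge0_emeasurable_sum; last by move=> k _; exact: mind.
    by move=> k tau _ _; exact: ind0.
  congr (_ + _)%E; rewrite [LHS](integral_cst _ _ a%:E)//.
  rewrite EFinM; congr (_ * _)%E; apply: etrans (lebesgue_measure_itv `]0, t]) _.
  by rewrite /= lte_fin t0 sube0.
rewrite -addeA leeD2l//.
rewrite integral_nneseries//.
apply: (@le_trans _ _ (\sum_(0 <= k <oo) \int[mu]_(x in E) (delta * \1_(L k) x)%:E)%E).
  apply: lee_nneseries => [k _ _|k _]; first by apply: integral_ge0 => x _; exact: ind0.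
  under eq_integral do rewrite EFinM.
  under [leRHS]eq_integral do rewrite EFinM.
  rewrite !ge0_integralZl_EFin ?(ltW d0)//; try by apply/measurable_EFinP; exact: measurable_indic.
  rewrite !integral_indic// (_ : L k `&` E = L k) ?muL; last exact: setIidl.
  apply: lee_wpmul2l; first by rewrite lee_fin ltW.
  apply: (@le_trans _ _ (@lebesgue_measure R `]0%R, m k])).
    by apply: le_measure; rewrite ?inE//; exact: measurableI.
  rewrite lebesgue_measure_itv/= lte_fin; case: ifPn => _; last by rewrite lee_fin.
  by rewrite sube0.
rewrite -integral_nneseries//; last 2 first.
- by move=> k; apply/measurable_EFinP; apply: measurable_funM => //; exact: measurable_indic.
- by move=> k x _; rewrite lee_fin mulr_ge0// ltW.
apply: (@le_trans _ _ (\int[mu]_(x in E) ((f x - a)%:E + delta%:E))%E).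
  apply: ge0_le_integral => //.
  - by move=> x _; apply: nneseries_ge0 => k _ _; rewrite lee_fin mulr_ge0// ltW.
  - apply: ge0_emeasurable_sum.
      by move=> k x _ _; rewrite lee_fin mulr_ge0// ltW.
    by move=> k _; apply/measurable_EFinP; apply: measurable_funM => //; exact: measurable_indic.
  - by apply: emeasurable_funD.
  - move=> x [Qx /= ax]; apply: lime_le.
      by apply: is_cvg_nneseries => k _ _; rewrite lee_fin mulr_ge0// ltW.
    apply: nearW => K; rewrite sumEFin -EFinD lee_fin addrC.
    apply: le_trans (sum_levels_le K d0 (_ : 0 <= f x - a)); last by rewrite subr_ge0 ltW.
    apply: ler_sum => k _; rewrite ler_pM2l// indicE.
    case: (boolP (x \in L k)) => //; rewrite inE => -[_ /= kx].
    by rewrite ltrBrDl kx.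
rewrite ge0_integralD//; last by move=> x _; rewrite lee_fin ltW.
  rewrite leeD2l// [leLHS](integral_cst _ _ delta%:E)//.
  rewrite (finQ E)//; last by move=> x [].
  rewrite -EFinM lee_fin /delta mulrAC ler_pdivrMr// ler_pM2l//; lra.
by move=> x [_ /= /ltW]; rewrite lee_fin subr_ge0.
Qed.

End rearrangement.

(** * The estimate on the cubes of the covering *)

(** Up to a null set, [g] on [E] is at most the sum of its restrictions to the [F k]. Summing the
    hypotheses costs the factor [B], since the indicators of the [F k] add up to at most [B] on
    [E]. *)
Lemma integral_bounded_overlap_le d (T : measurableType d) (R : realType)
    (mu : {measure set T -> \bar R}) (E : set T) (F : nat -> set T)
    (g : T -> \bar R) (c : R) (B : nat) :
  measurable E -> (forall k, measurable (F k)) -> measurable_fun E g ->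
  (forall x, E x -> (0 <= g x)%E) -> mu (E `\` \bigcup_k F k) = 0%E -> 0 <= c ->
  (forall k, (\int[mu]_(x in E `&` F k) g x <= c%:E * mu (E `&` F k))%E) ->
  (forall x, E x -> forall s : seq nat, uniq s ->
     (forall i, i \in s -> F i x) -> (size s <= B)%N) ->
  (\int[mu]_(x in E) g x <= (c * B%:R)%:E * mu E)%E.
Proof.
move=> mE mF mg g0 N0 c0 gF Fov.
have mU : measurable (\bigcup_k F k) by exact: bigcup_measurable.
rewrite (ge0_negligible_integral _ mE mg g0 N0); last exact: measurableD.
have -> : E `\` (E `\` \bigcup_k F k) = E `&` \bigcup_k F k.
  by rewrite setDD.
set E' := E `&` _.
have mE' : measurable E' by exact: measurableI.
have E'E : E' `<=` E by move=> x [].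
have mgF k : measurable_fun E' (g \_ (F k)).
  apply/(measurable_restrict _ (mF k) mE').
  by apply: (measurable_funS mE _ mg) => x [[]].
have gF0 k x : E' x -> (0 <= (g \_ (F k)) x)%E.
  by move=> E'x; rewrite patchE; case: ifPn => // _; apply: g0; exact: E'E.
apply: (@le_trans _ _ (\int[mu]_(x in E') \sum_(0 <= k <oo) (g \_ (F k)) x)%E).
  apply: ge0_le_integral => //.
  - by move=> x /E'E /g0.
  - exact: (measurable_funS mE _ mg).
  - by apply: ge0_emeasurable_sum => // k x E'x _; exact: gF0.
  - move=> x /[dup] E'x [Ex [k _ kx]].
    apply: le_trans (nneseries_lim_ge k.+1 _) => [|i _ _]; last exact: gF0.
    rewrite big_nat_recr//= [X in (_ + X)%E]patchE mem_set// leeDr//.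
    by apply: sume_ge0 => i _; exact: gF0.
rewrite integral_nneseries//.
apply: (@le_trans _ _ (\sum_(0 <= k <oo) c%:E * \int[mu]_(x in E) (\1_(F k) x)%:E)%E).
  apply: lee_nneseries => [k _ _|k _].
    by apply: integral_ge0 => x /gF0.
  rewrite -integral_mkcondr integral_indic//.
  rewrite (_ : E' `&` F k = E `&` F k) 1?[F k `&` E]setIC//.
  apply/seteqP; split => [x [/E'E]//|x [Ex kx]].
  by split => //; split => //; exists k.
rewrite nneseriesZl; last by move=> k _; apply: integral_ge0 => x _; rewrite lee_fin.
rewrite EFinM -muleA; apply: lee_wpmul2l; first by rewrite lee_fin.
rewrite -integral_nneseries//; last first.
  by move=> k; apply/measurable_EFinP; exact: measurable_indic.
have -> : (B%:R%:E * mu E = \int[mu]_(x in E) B%:R%:E)%E.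
  by rewrite [RHS](integral_cst _ _ B%:R%:E).
apply: ge0_le_integral => //.
- by move=> x _; apply: nneseries_ge0 => k _ _; rewrite lee_fin.
- apply: ge0_emeasurable_sum; first by move=> k x _ _; rewrite lee_fin.
  by move=> k _; apply/measurable_EFinP; exact: measurable_indic.
move=> x Ex; apply: lime_le.
  by apply: is_cvg_nneseries => k _ _; rewrite lee_fin.
apply: nearW => K; rewrite sumEFin lee_fin.
under eq_bigr do rewrite indicE.
rewrite -natr_sum ler_nat.
rewrite (eq_bigr (fun k => if x \in F k then 1 else 0)%N); last first.
  by move=> k _; case: (x \in F k).
rewrite -big_mkcond sum1_count -size_filter.
apply: (Fov x Ex); first by rewrite filter_uniq// iota_uniq.
by move=> i; rewrite mem_filter => /andP[]; rewrite inE.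
Qed.

Lemma integrable_cst_finite d (T : measurableType d) (R : realType)
    (mu : {measure set T -> \bar R}) (Q : set T) (r : R) :
  measurable Q -> (mu Q < +oo)%E -> mu.-integrable Q (EFin \o cst r).
Proof.
move=> mQ Qfin; apply/integrableP; split; first exact/measurable_EFinP.
rewrite [X in (X < _)%E](integral_cst _ _ `|r|%:E)//.
by rewrite lte_mul_pinfty// lee_fin.
Qed.

(** The arithmetic for one cube [Q]: [m] is its measure, [F] the mean of [f], and [S] and [V] are
    the integrals of [f] over the parts of [Q] inside and outside [E]. *)
Lemma excess_le (R : realType) (S V m F a eps lambda rho : R) :
  0 < m -> 0 <= a -> 0 < eps -> eps < lambda -> 0 < rho -> rho < 1 - lambda / 2 ->
  S + V = F * m -> V <= a * (m - rho * m) ->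
  2 * (S - F * (rho * m)) <= eps * F * m ->
  S - a * (rho * m) <= (lambda / rho + 1) / (lambda - eps) * eps * a * (rho * m).
Proof.
move=> m0 a0 e0 el r0 rl SV Va SF.
have le0 : 0 < lambda - eps by rewrite subr_gt0.
(* When [F > a], the hypotheses give [2 * (1 - rho) * (F - a) <= eps * F], and [2 * (1 - rho)]
   exceeds [lambda]. *)
have Fa : (lambda - eps) * F <= lambda * a.
  have [Fa|aF] := leP F a; first by nra.
  have : 2 * (1 - rho) * (F - a) <= eps * F.
    rewrite -(ler_pM2r m0); lra.
  nra.
have -> : (lambda / rho + 1) / (lambda - eps) * eps * a * (rho * m) =
    (lambda + rho) * eps * a * m / (lambda - eps).
  by field; rewrite !gt_eqF.
rewrite ler_pdivlMr//.
(* The excess over [a] splits as [S - F * (rho * m)], which yields the term [lambda / rho], and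
   [(F - a) * (rho * m)], which yields the term 1. A factor 2 is given up in the first. *)
have H1 : (S - F * (rho * m)) * (lambda - eps) <= eps * lambda * a * m.
  have : 2 * (S - F * (rho * m)) * (lambda - eps) <= eps * F * m * (lambda - eps).
    by rewrite ler_pM2r.
  have : eps * m * ((lambda - eps) * F) <= eps * m * (lambda * a).
    by rewrite ler_pM2l// mulr_gt0.
  have : 0 <= eps * lambda * a * m.
    by rewrite !mulr_ge0// ltW// (lt_trans e0).
  lra.
have H2 : (F - a) * (lambda - eps) <= eps * a by lra.
have H3 : (F - a) * (lambda - eps) * (rho * m) <= eps * a * (rho * m).
  by rewrite ler_pM2r// mulr_gt0.
lra.
Qed.

Lemma integral_excess_le d (T : measurableType d) (R : realType)
    (mu : {measure set T -> \bar R}) (f : T -> R) (Q E : set T) (a eps lambda rho : R) :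
  measurable Q -> measurable E -> (0 < mu Q)%E -> (mu Q < +oo)%E ->
  mu.-integrable Q (EFin \o f) ->
  (forall x, Q x -> ~ E x -> f x <= a) -> mu (Q `&` E) = (rho%:E * mu Q)%E ->
  0 <= a -> 0 < eps -> eps < lambda -> 0 < rho -> rho < 1 - lambda / 2 ->
  osc mu f Q <= eps * avg mu f Q ->
  (\int[mu]_(x in Q `&` E) (f x - a)%:E <=
    ((lambda / rho + 1) / (lambda - eps) * eps * a)%:E * mu (Q `&` E))%E.
Proof.
move=> mQ mE Q0 Qfin fint fa muQE a0 e0 el r0 rl oscf.
have mQE : measurable (Q `&` E) by exact: measurableI.
have mQD : measurable (Q `\` E) by exact: measurableD.
have muQ : mu Q = (fine (mu Q))%:E by rewrite fineK// ge0_fin_numE.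
have m0 : 0 < fine (mu Q) by apply: fine_gt0; rewrite Q0.
move: oscf; rewrite /osc /avg; set m := fine (mu Q) in muQ m0 *.
set F := fine (\int[mu]_(x in Q) (f x)%:E)%E / m.
have muE : fine (mu (Q `&` E)) = rho * m by rewrite muQE muQ.
have QEfin : (mu (Q `&` E) < +oo)%E by rewrite muQE muQ -EFinM ltry.
have QDfin : (mu (Q `\` E) < +oo)%E.
  by apply: le_lt_trans Qfin; apply: le_measure; rewrite ?inE// => x [].
have muD : fine (mu (Q `\` E)) = m - rho * m.
  have -> : mu (Q `\` E) = (mu Q - mu (Q `&` E))%E by exact: measureD.
  by rewrite muQE muQ.
have QU : Q = (Q `&` E) `|` (Q `\` E) by rewrite setUIDK.
have dis : [disjoint Q `&` E & Q `\` E].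
  by apply/disj_setPS => x [[_ Ex] [_ ]].
have intS (A : set T) (g : T -> R) : measurable A -> A `<=` Q ->
    mu.-integrable Q (EFin \o g) -> mu.-integrable A (EFin \o g).
  by move=> mA AQ; exact: integrableS.
have QEQ : Q `&` E `<=` Q by move=> x [].
have QDQ : Q `\` E `<=` Q by move=> x [].
have cint r : mu.-integrable Q (EFin \o cst r) by exact: integrable_cst_finite.
have fcint r : mu.-integrable Q (EFin \o (fun x => f x - r)).
  exact: (integrableB mQ fint (cint r)).
have cfint r : mu.-integrable Q (EFin \o (fun x => r - f x)).
  exact: (integrableB mQ (cint r) fint).
have absint r : mu.-integrable Q (EFin \o (fun x => `|f x - r|)).
  exact: (integrable_norm (fcint r)).
have IE r : \int[mu]_(x in Q `&` E) (f x - r) =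
    \int[mu]_(x in Q `&` E) f x - r * (rho * m).
  rewrite RintegralB//; [|exact: intS|exact: (intS _ (cst r))].
  by rewrite Rintegral_cst// muE.
have ID r : \int[mu]_(x in Q `\` E) (r - f x) =
    r * (m - rho * m) - \int[mu]_(x in Q `\` E) f x.
  rewrite RintegralB//; [|exact: (intS _ (cst r))|exact: intS].
  by rewrite Rintegral_cst// muD.
have SV : \int[mu]_(x in Q `&` E) f x + \int[mu]_(x in Q `\` E) f x = F * m.
  rewrite -Rintegral_setU//; last by rewrite -QU.
  by rewrite -QU /F divfK// gt_eqF.
have Va : \int[mu]_(x in Q `\` E) f x <= a * (m - rho * m).
  rewrite -subr_ge0 -ID; apply: Rintegral_ge0 => x [Qx nEx].
  by rewrite subr_ge0; exact: fa.
rewrite ler_pdivrMr// => oscf.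
(* Since [f - F] has integral zero over [Q], its integral over [Q]&[E] equals that of [F - f] over
   the rest of [Q]; the oscillation dominates their sum. *)
have SF : 2 * (\int[mu]_(x in Q `&` E) f x - F * (rho * m)) <= eps * F * m.
  apply: le_trans oscf.
  rewrite -[fine _]/(\int[mu]_(x in Q) `|f x - F|).
  rewrite [in leRHS]QU Rintegral_setU//; last by rewrite -QU.
  have : \int[mu]_(x in Q `&` E) (f x - F) <= \int[mu]_(x in Q `&` E) `|f x - F|.
    apply: le_Rintegral => //; [exact: intS|exact: (intS _ _ _ _ (absint F))|].
    by move=> x _; exact: ler_norm.
  have : \int[mu]_(x in Q `\` E) (F - f x) <= \int[mu]_(x in Q `\` E) `|f x - F|.
    apply: le_Rintegral => //; [exact: intS|exact: (intS _ _ _ _ (absint F))|].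
    by move=> x _; rewrite distrC; exact: ler_norm.
  by rewrite IE ID; move: SV; lra.
have := excess_le m0 a0 e0 el r0 rl SV Va SF.
rewrite -IE -lee_fin => le1.
rewrite muQE muQ -!EFinM; apply: le_trans le1.
rewrite /Rintegral fineK//.
by apply: integrable_fin_num => //; exact: (intS _ _ _ _ (fcint a)).
Qed.

(** * Summation over the covering and conclusion *)

Lemma density_pointS (R : realType) (n : nat)
    (mu : {measure set (Rn R n) -> \bar R}) (A B : set (Rn R n)) (x : Rn R n) :
  measurable A -> measurable B -> A `<=` B ->
  density_point mu A x -> density_point mu B x.
Proof.
move=> mA mB AB dA e e0; have [r0 [r00 H]] := dA e e0.
exists r0; split => // r rpos rr0; have [Q0 [Qfin Ae]] := H r rpos rr0.
split => //; split => //; apply: le_lt_trans Ae.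
have mQ : measurable (ccube x r : set (Rn R n)) by exact: measurable_ccube.
have mAQ : measurable (A `&` ccube x r : set (Rn R n)) by exact: measurableI.
have mBQ : measurable (B `&` ccube x r : set (Rn R n)) by exact: measurableI.
have BQ : (mu (B `&` ccube x r) <= mu (ccube x r))%E by apply: le_measure; rewrite ?inE.
have AQ : (mu (A `&` ccube x r) <= mu (B `&` ccube x r))%E.
  by apply: le_measure; rewrite ?inE// => y [/AB].
have Qf : mu (ccube x r) \is a fin_num by rewrite ge0_fin_numE.
have Bf : mu (B `&` ccube x r) \is a fin_num by rewrite ge0_fin_numE// (le_lt_trans BQ).
have Af : mu (A `&` ccube x r) \is a fin_num.
  by rewrite ge0_fin_numE// (le_lt_trans AQ)// (le_lt_trans BQ).
have q0 : 0 < fine (mu (ccube x r)) by apply: fine_gt0; rewrite Q0.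
have bq : fine (mu (B `&` ccube x r)) <= fine (mu (ccube x r)) by exact: fine_le.
have ab : fine (mu (A `&` ccube x r)) <= fine (mu (B `&` ccube x r)) by exact: fine_le.
rewrite ler0_norm; last by rewrite subr_le0 ler_pdivrMr// mul1r.
rewrite ler0_norm; last by rewrite subr_le0 ler_pdivrMr// mul1r (le_trans ab).
by rewrite lerN2 lerB// ler_pM2r// invr_gt0.
Qed.

(* In dimension 0 no subset of [Q0] has measure in ]0, mu Q0[, so that [fstar]
   is the supremum of the empty set. *)
Lemma fstarstar_dim0 (R : realType) (mu : {measure set (Rn R 0) -> \bar R})
    (Q0 : set (Rn R 0)) (f : Rn R 0 -> R) (t : R) :
  is_cube Q0 -> 0 < t -> (t%:E < mu Q0)%E -> fstarstar mu f Q0 t = -oo%E.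
Proof.
move=> [c [r [r0 ->]]] t0 tQ.
have fstarN tau : 0 < tau -> tau <= t -> fstar mu f (ccube c r) tau = -oo%E.
  move=> tau0 taut; rewrite /fstar (_ : [set _ | _ in _] = set0) ?ereal_sup0//.
  apply/seteqP; split => // y [E [mE [EQ muE]] _].
  have [E0|/set0P[x Ex]] := eqVneq E set0.
    by move: muE; rewrite E0 measure0 => -[] tau00; move: tau0; rewrite -tau00 ltxx.
  have : E = ccube c r.
    apply/seteqP; split => // z _; rewrite (_ : z = x)//.
    by apply/funext => -[].
  move=> EE; move: muE tQ; rewrite EE => ->; rewrite lte_fin ltNge.
  by rewrite taut.
rewrite /fstarstar.
have -> : (\int[@lebesgue_measure R]_(tau in `]0%R, t]%classic) fstar mu f (ccube c r) tau =
    \int[@lebesgue_measure R]_(tau in `]0%R, t]%classic) -oo)%E.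
  apply: eq_integral => tau; rewrite inE/= in_itv/= => /andP[? ?].
  exact: fstarN.
rewrite [X in (_ * X)%E](_ : _ = -oo * @lebesgue_measure R `]0%R, t])%E; last first.
  exact: integral_cst.
rewrite lebesgue_measure_itv/= lte_fin t0 sube0.
by rewrite gt0_mulNye ?lte_fin// gt0_muleNy// lte_fin invr_gt0.
Qed.

(** Each cube of the covering satisfies [integral_excess_le], and [integral_bounded_overlap_le] adds
    these estimates up. *)
Lemma covering_excess_le (R : realType) (n B : nat)
    (mu : {measure set (Rn R n) -> \bar R})
    (Q0 E : set (Rn R n)) (eps lambda rho a : R) (f : Rn R n -> R) :
  covering_property R n B -> abs_cont_lebesgue mu -> is_cube Q0 ->
  (0 < mu Q0)%E -> (mu Q0 < +oo)%E -> 0 < eps -> GR mu eps Q0 f ->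
  eps < lambda -> 0 < rho -> rho < 1 - lambda / 2 -> 0 <= a ->
  E = Q0 `&` [set x | a < f x] -> (mu E <= rho%:E * mu Q0)%E ->
  (\int[mu]_(x in E) (f x - a)%:E <=
    ((lambda / rho + 1) / (lambda - eps) * eps * a * B%:R)%:E * mu E)%E.
Proof.
move=> HB Hac HQ0 Q0pos Q0fin e0 [f0 [fint fosc]] el r0 rl a0 EE muE.
have [c0 [R0 [R00 Q0E]]] := HQ0.
have mQ0 : measurable Q0 by rewrite Q0E; exact: measurable_ccube.
have mE : measurable E by rewrite EE; exact: (measurable_superlevel mQ0 fint).
have EQ : E `<=` Q0 by rewrite EE => x [].
(* [HB] is applied to the restriction of [mu] to [Q0]: [mu] itself may be
   infinite on every cube centred at a boundary point of [Q0]. *)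
pose mu' : {measure set (Rn R n) -> \bar R} := mrestr mu mQ0.
have mu'E A : mu' A = mu (A `&` Q0) by [].
have Hac' : abs_cont_lebesgue mu'.
  move=> A mA A0; rewrite mu'E; apply: Hac; first exact: measurableI.
  move=> delta /A0[I [c [r [rI [sub small]]]]]; exists I, c, r; split => //; split => //.
  by apply: subset_trans sub => x [].
have mu'Q0 : mu' Q0 = mu Q0 by rewrite mu'E setIid.
have mu'T : (mu' setT < +oo)%E by rewrite mu'E setTI.
have r1 : rho < 1 by lra.
have [I [Q [QI [Qov Qd]]]] : exists (I : set nat) (Q : nat -> set (Rn R n)),
      (forall i, I i -> [/\ is_cube (Q i), Q i `<=` Q0 &
                           mu' (Q i `&` E) = (rho%:E * mu' (Q i))%E]) /\
      (forall x, Q0 x -> forall s : seq nat, uniq s ->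
          (forall i, i \in s -> I i /\ Q i x) -> (size s <= B)%N) /\
      (density_point mu' E `<=` \bigcup_(i in I) Q i).
  apply: HB => //; rewrite ?mu'Q0//.
  by rewrite mu'E setIidl.
have mQ i : I i -> measurable (Q i).
  by move=> /QI[[c [r [rr ->]]] _ _]; exact: measurable_ccube.
have muQE i : I i -> mu (Q i `&` E) = (rho%:E * mu (Q i))%E.
  move=> /QI[_ QQ0]; rewrite !mu'E (_ : Q i `&` E `&` Q0 = Q i `&` E) 1?(setIidl QQ0)//.
  by apply: setIidl => x [/QQ0].
pose F i := if i \in I then Q i else set0.
have mF i : measurable (F i).
  by rewrite /F; case: ifPn => //; rewrite inE; exact: mQ.
have FI i x : F i x -> I i /\ Q i x.
  by rewrite /F; case: ifPn => //; rewrite inE.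
apply: (@integral_bounded_overlap_le _ _ _ mu E F) => //.
- apply/measurable_EFinP; apply: measurable_funB => //.
  have /measurable_int/measurable_EFinP := fint.
  exact: measurable_funS.
- by rewrite EE => x [_ /= ax]; rewrite lee_fin subr_ge0 ltW.
- have mN : measurable (E `\` \bigcup_k F k).
    by apply: measurableD => //; exact: bigcup_measurable.
  have NQ0 : E `\` \bigcup_k F k `<=` Q0 by move=> x [/EQ].
  suff : mu' (E `\` \bigcup_k F k) = 0%E by rewrite mu'E setIidl.
  (* A density point of the uncovered part of [E] would be a density point of [E], hence covered; so
     the uncovered part contains none of its own density points. *)
  apply: (@density_null _ _ mu' _ c0 R0) => //; first by rewrite -Q0E.
  move=> x [Ex nFx] /(density_pointS mN mE) dx; apply: nFx.
  have [|i Ii Qx] := Qd x; first by apply: dx => y [].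
  by exists i => //; rewrite /F mem_set.
- rewrite !mulr_ge0//; last exact: ltW.
    by rewrite addr_ge0// divr_ge0 ?(ltW r0)// ltW// (lt_trans e0).
  by rewrite invr_ge0 subr_ge0 ltW.
- move=> i; rewrite /F; case: ifPn => [|_]; last first.
    by rewrite setI0 integral_set0 measure0 mule0.
  rewrite inE => Ii; rewrite setIC.
  have [cQ QQ0 _] := QI i Ii.
  have Qfin : (mu (Q i) < +oo)%E.
    by apply: le_lt_trans Q0fin; apply: le_measure; rewrite ?inE//; exact: mQ.
  (* The oscillation condition concerns cubes of positive measure only; on a null cube both sides
     vanish. *)
  have [Qi0|Qi0] := eqVneq (mu (Q i)) 0%E.
    have QE0 : mu (Q i `&` E) = 0%E by rewrite muQE// Qi0 mule0.
    rewrite null_set_integral ?QE0 ?mule0//.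
      by apply: measurableI => //; exact: mQ.
    apply/measurable_EFinP; apply: measurable_funB => //.
    have /measurable_int/measurable_EFinP := fint.
    by apply: measurable_funS => // x [/QQ0].
  have Qipos : (0 < mu (Q i))%E by rewrite lt0e Qi0 measure_ge0.
  apply: integral_excess_le => //; [exact: mQ| | |exact: muQE|exact: fosc].
    by apply: (integrableS mQ0 _ QQ0 fint); exact: mQ.
  move=> x /QQ0 Qx nEx; rewrite leNgt; apply/negP => ax; apply: nEx.
  by rewrite EE.
- move=> x /EQ Qx s us sF; apply: (Qov x Qx s us) => i /sF; exact: FI.
Qed.

Theorem theorem2 (R : realType) (n B : nat)
  (HB : covering_property R n B)
  (mu : {measure set (Rn R n) -> \bar R})
  (Hac : abs_cont_lebesgue mu)
  (Q0 : set (Rn R n)) (HQ0 : is_cube Q0)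
  (HQ0pos : (0 < mu Q0)%E) (HQ0fin : (mu Q0 < +oo)%E)
  (eps : R) (Heps0 : 0 < eps) (Heps2 : eps < 2)
  (f : Rn R n -> R) (Hf : GR mu eps Q0 f)
  (lambda rho t : R)
  (Hl1 : eps < lambda) (Hl2 : lambda < 2)
  (Hr1 : 0 < rho) (Hr2 : rho < 1 - lambda / 2)
  (Ht1 : 0 < t) (Ht2 : (t%:E <= rho%:E * mu Q0)%E) :
  (fstarstar mu f Q0 t <=
   (B%:R * ((lambda / rho + 1) / (lambda - eps)) * eps + 1)%:E
     * fstar mu f Q0 t)%E.
Proof.
have r1 : rho < 1 by lra.
have muQ : mu Q0 = (fine (mu Q0))%:E by rewrite fineK// ge0_fin_numE.
have tQ : (t%:E < mu Q0)%E.
  apply: (le_lt_trans Ht2); move: HQ0pos; rewrite muQ -EFinM !lte_fin => q0.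
  by rewrite gtr_pMl.
destruct n as [|n]; first by rewrite fstarstar_dim0// leNye.
have [c0 [R0 [R00 Q0E]]] := HQ0.
have mQ0 : measurable Q0 by rewrite Q0E; exact: measurable_ccube.
have [f0 [fint _]] := Hf.
have mge s : measurable (Q0 `&` [set x | s <= f x]).
  have /measurable_int/measurable_EFinP mf := fint.
  rewrite (_ : [set x | _] = f @^-1` `[s, +oo[%classic); first exact: mf.
  by apply/seteqP; split => x /=; rewrite in_itv/= andbT.
have [a [a0 ta at_]] := quantile mQ0 HQ0fin mge f0 Ht1 (ltW tQ).
(* A subset of [f >= a] of measure exactly [t] competes in the supremum defining [fstar]. *)
have fstara : (a%:E <= fstar mu f Q0 t)%E.
  have [||E [mE EA muE]] := @exists_subset_of_measure R n mu
      (Q0 `&` [set x | a <= f x]) c0 R0 t Hac (mge a) _ R00 _ Ht1 ta.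
  - by apply: le_lt_trans HQ0fin; apply: le_measure; rewrite ?inE// => x [].
  - by rewrite -Q0E => x [].
  by apply: (fstar_ge mE _ muE) => [x /EA[]|x /EA[]].
(* Subsets of measure [tau] exist, so the supremum is not taken over the empty set, where it would
   be [-oo]. *)
have fstar0 tau : 0 < tau -> tau <= t -> (0 <= fstar mu f Q0 tau)%E.
  move=> tau0 taut.
  have [||E [mE EA muE]] := @exists_subset_of_measure R n mu
      Q0 c0 R0 tau Hac mQ0 HQ0fin R00 _ tau0.
  - by rewrite -Q0E.
  - by apply: le_trans (ltW tQ); rewrite lee_fin.
  by apply: (fstar_ge mE EA muE) => x /EA /f0.
have := integral_fstar_le mQ0 HQ0fin fint f0 a0 Ht1 fstar0.
set E := Q0 `&` [set x | a < f x] in at_ *.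
have muE : (mu E <= rho%:E * mu Q0)%E by exact: le_trans Ht2.
have := covering_excess_le HB Hac HQ0 HQ0pos HQ0fin Heps0 Hf Hl1 Hr1 Hr2 a0 (erefl E) muE.
set K := _ * eps * a * B%:R => EK IE.
have K0 : 0 <= (lambda / rho + 1) / (lambda - eps).
  rewrite divr_ge0 ?subr_ge0 ?(ltW Hl1)// addr_ge0// divr_ge0 ?(ltW Hr1)//.
  by rewrite ltW// (lt_trans Heps0).
have {}EK : (\int[mu]_(x in E) (f x - a)%:E <= (K * t)%:E)%E.
  apply: (le_trans EK); rewrite [leRHS]EFinM; apply: lee_wpmul2l => //.
  by rewrite lee_fin /K mulr_ge0// mulr_ge0// mulr_ge0// ltW.
(* The estimate is proved with [a], then passes to [fstar] by [fstara], the constant being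
   nonnegative. *)
apply: (@le_trans _ _ ((B%:R * ((lambda / rho + 1) / (lambda - eps)) * eps + 1) * a)%:E).
  rewrite /fstarstar.
  apply: (@le_trans _ _ ((t^-1)%:E * (a * t + K * t)%:E)%E).
    apply: lee_wpmul2l; first by rewrite lee_fin invr_ge0 ltW.
    by apply: (le_trans IE); rewrite EFinD leeD2l.
  rewrite -EFinM lee_fin -mulrDl mulrCA mulVf ?gt_eqF// mulr1 /K.
  set k := (_ + _) / _; lra.
rewrite EFinM; apply: lee_wpmul2l => //.
by rewrite lee_fin addr_ge0// mulr_ge0 ?(ltW Heps0)// mulr_ge0.
Qed.
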